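(* (a) Let $q$ be a prime power, $n = q^2+1$ and $m = qn$. Then $z(m,n,2,3) = (q^2+q)n$. (b) Let $r \ge 4$ be fixed and let $m = m(n)$ satisfy $m = (1+o(1))n^{r/2}$ for integers $n$. Then $z(m,n,2,r) = (1+o(1))\sqrt{n}\,m$ as $n \to \infty$.
   Context: The Zarankiewicz number $z(m,n,s,t)$ is the maximum number of edges in a bipartite graph with parts $A$, $B$ of sizes $m$, $n$ containing no complete bipartite subgraph with $s$ vertices in $A$ and $t$ vertices in $B$. *)

(* Defs.v *)
From mathcomp Require Import all_boot.

Set Implicit Arguments.
Unset Strict Implicit.
Unset Printing Implicit Defensive.

(* A bipartite graph with parts A and B is represented by its edge set
   E : {set A * B}.  The parts are ordered, so in K_{s,t} the s vertices lie
   in A and the t vertices in B. *)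
Definition complete_bip_free (A B : finType) (s t : nat) (E : {set A * B}) :
    bool :=
  ~~ [exists S : {set A}, exists T : {set B},
        [&& #|S| == s, #|T| == t & setX S T \subset E]].

Definition zarankiewicz (m n s t : nat) : nat :=
  \max_(E : {set 'I_m * 'I_n} | complete_bip_free s t E) #|E|.

Definition prime_power (q : nat) : Prop :=
  exists p k : nat, [/\ prime p, 0 < k & q = p ^ k].

(* Main.v *)
(* (a) Two vertices of A never share t vertices of B, so every t-subset of B lies
   in at most one neighbourhood and the sum of C(deg a, t) over A is at most
   C(n, t).  For t = 3 convexity of C(d, 3) at d = q + 1 gives the upper bound,
   which the inversive plane of order q attains: its points are F_{q^2} and oo,
   its blocks the circles N(x - u) = d and the lines Tr(b x) = e together with oo.

   (b) The same convexity argument gives the upper bound.  For the lower bound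
   the graphs of the polynomials of degree < r over F_q are q^r sets of size q in
   a set of size q^2, any two sharing fewer than r points.  One needs a prime
   power q ~ sqrt n for every n, i.e. that consecutive prime powers have ratio
   tending to 1; this is derived from Selberg's symmetry formula
     psi(x) log x + sum_{k <= x} Lambda(k) psi(x/k) = 2 x log x + O(x)
   as in Erdos's first step towards the prime number theorem.  The formula bounds
   psi(y) - psi(x) by 2 (y - x) + o(x).  If (x, (1+c)x] has no prime powers, it
   forces (x/k, (1+c)x/k] to have nearly this maximal mass for almost all prime
   powers k.  For such a k = p there is such an a just above x/p; then x/a is just
   below p, so (p, (1+c)p] has density 2 and contains a further such p'.
   Iterating p -> p' yields p0 < p1 with p1 >= 100 p0 and density about 2 on
   (p0, p1], against psi(x) <= 7/4 x. *)
Require Import Defs.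
From mathcomp Require Import all_boot all_order all_algebra all_solvable all_field.
From mathcomp Require Import ring lra zify.
Import Order.TTheory GRing.Theory Num.Theory.

(** * Zarankiewicz numbers and set systems *)

(** The [F i] become neighbourhoods. Vertices outside the images of [I] and [B] stay isolated, so
    one family serves all larger parts. *)
Lemma leq_zarankiewicz_family (I B : finType) (F : I -> {set B}) m n t :
  0 < t -> #|I| <= m -> #|B| <= n ->
  (forall i j, i != j -> #|F i :&: F j| < t) ->
  \sum_i #|F i| <= zarankiewicz m n 2 t.
Proof.
move=> t0 Im Bn small.
pose f (i : I) : 'I_m := widen_ord Im (enum_rank i).
pose g (b : B) : 'I_n := widen_ord Bn (enum_rank b).
have f_inj : injective f by move=> i j /(congr1 val)/= /val_inj/enum_rank_inj.
have g_inj : injective g by move=> i j /(congr1 val)/= /val_inj/enum_rank_inj.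
pose h (p : I * B) := (f p.1, g p.2).
have h_inj : injective h.
  case=> i b [j c] /eqP; rewrite /h /= xpair_eqE (inj_eq f_inj) (inj_eq g_inj) => /andP[].
  by move=> /eqP -> /eqP ->.
pose E := h @: [set p : I * B | p.2 \in F p.1].
have -> : \sum_i #|F i| = #|E|.
  rewrite card_imset // -sum1dep_card.
  rewrite (eq_bigl (fun p : I * B => predT p.1 && (p.2 \in F p.1))) //.
  rewrite -(pair_big_dep predT (fun i b => b \in F i) (fun _ _ => 1)) /=.
  by apply: eq_bigr => i _; rewrite sum1_card.
apply: (leq_bigmax_cond (F := fun E : {set 'I_m * 'I_n} => #|E|)).
rewrite /complete_bip_free; apply/existsP => -[S /existsP[T /and3P[S2 Tt STE]]].
have memE a b : a \in S -> b \in T -> exists i c, [/\ a = f i, b = g c & c \in F i].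
  move=> aS bT; have : (a, b) \in E by rewrite (subsetP STE) // inE aS.
  case/imsetP => -[i c]; rewrite inE /= => cF /eqP; rewrite /h /=.
  by rewrite xpair_eqE => /andP[/eqP -> /eqP ->]; exists i, c.
have [a [a' [aS a'S aa']]] : exists a a', [/\ a \in S, a' \in S & a != a'].
  by move: S2 => /cards2P[a [a' [? ->]]]; exists a, a'; rewrite !inE !eqxx orbT.
(* As [t] is positive, some [b0] is joined to both vertices, so neither is an isolated padding
   vertex. *)
have /card_gt0P[b0 b0T] : 0 < #|T| by rewrite (eqP Tt).
have [i [_ [ai _ _]]] := memE a b0 aS b0T.
have [j [_ [a'j _ _]]] := memE a' b0 a'S b0T.
have ij : i != j by apply: contra_neq aa' => ij; rewrite ai a'j ij.
have : T \subset g @: (F i :&: F j).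
  apply/subsetP => b bT.
  have [i1 [c [e1 e2 cF]]] := memE a b aS bT.
  have [j1 [c' [e3 e4 c'F]]] := memE a' b a'S bT.
  have ii : i = i1 by apply: f_inj; rewrite -ai.
  have jj : j = j1 by apply: f_inj; rewrite -a'j.
  have cc : c = c' by apply: g_inj; rewrite -e2.
  by rewrite e2; apply: imset_f; rewrite inE ii cF jj cc c'F.
move=> /subset_leq_card; rewrite (eqP Tt) card_imset // leqNgt.
by rewrite small.
Qed.

Definition neighbours (A B : finType) (E : {set A * B}) (a : A) : {set B} :=
  [set b | (a, b) \in E].
Arguments neighbours {A B} E a.

Lemma sum_card_neighbours (A B : finType) (E : {set A * B}) :
  \sum_a #|neighbours E a| = #|E|.
Proof.
rewrite -sum1_card.
rewrite (eq_bigl (fun p : A * B => predT p.1 && (p.2 \in neighbours E p.1))); last first.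
  by move=> [a b] /=; rewrite [in RHS]inE.
rewrite -(pair_big_dep predT (fun a b => b \in neighbours E a) (fun _ _ => 1)) /=.
by apply: eq_bigr => i _; rewrite sum1_card.
Qed.

Lemma sum_bin_neighbours (A B : finType) (E : {set A * B}) t :
  complete_bip_free 2 t E ->
  \sum_a 'C(#|neighbours E a|, t) <= 'C(#|B|, t).
Proof.
move=> free; rewrite -card_draws.
under eq_bigr => a _ do rewrite -cards_draws -sum1dep_card big_andbC big_mkcondr.
rewrite exchange_big /= -sum1dep_card; apply: leq_sum => T Tt.
rewrite -big_mkcond sum1dep_card leqNgt; apply: contra free.
move=> /card_gt1P[a [a' [aT a'T aa']]].
apply/existsP; exists [set a; a']; apply/existsP; exists T.
rewrite cards2 aa' Tt /=; apply/subsetP => -[c b]; rewrite !inE /= => /andP[cS bT].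
move: aT a'T; rewrite !inE => aT a'T.
have : b \in neighbours E c by case/orP: cS => /eqP ->; apply: (subsetP _ _ bT).
by rewrite inE.
Qed.

(** The increments of ['C(d, k.+1)] are ['C(d, k)] and grow with [d]: this is the tangent at [s],
    with terms moved to avoid truncated subtraction. *)
Lemma bin_tangent d s k : 'C(s, k.+1) + d * 'C(s, k) <= 'C(d, k.+1) + s * 'C(s, k).
Proof.
have [sd|ds] := leqP s d.
  rewrite -(subnKC sd); elim: (d - s) => [|e IH]; first by rewrite addn0.
  rewrite addnS binS mulSn; have : 'C(s, k) <= 'C(s + e, k) by rewrite leq_bin2l ?leq_addr.
  lia.
rewrite -(subnKC (ltnW ds)); elim: (s - d) => [|e IH]; first by rewrite addn0.
rewrite addnS binS.
have : 'C(d + e, k) <= 'C((d + e).+1, k) by rewrite leq_bin2l.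
have : d <= d + e by rewrite leq_addr.
nia.
Qed.

(** * Constructions over finite fields *)

Local Open Scope ring_scope.

Lemma card_roots_lt (K : finFieldType) (p : {poly K}) (A : {set K}) :
  p != 0 -> {in A, forall x, root p x} -> (#|A| < size p)%N.
Proof.
move=> p0 rootA; rewrite cardE; apply: max_poly_roots => //; last exact: enum_uniq.
by apply/allP => x; rewrite mem_enum => /rootA.
Qed.

(** The sets are graphs of polynomials of degree below [t]; two of them meet over roots of the
    difference. The [minn] keeps only as many as fit into [m] vertices. *)
Lemma leq_zarankiewicz_poly q m n t : prime_power q -> (q ^ 2 <= n)%N -> (0 < t)%N ->
  (minn m (q ^ t) * q <= zarankiewicz m n 2 t)%N.
Proof.
move=> [p [k [p_pr k0 qE]]] qn t0.
have [F _ Fq] := pPrimePowerField p_pr k0; rewrite /= -qE in Fq.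
set N := minn m _.
have NF : (N <= #|{: 'rV[F]_t}|)%N by rewrite card_mx Fq mul1n geq_minr.
pose c (i : 'I_N) : 'rV[F]_t := enum_val (widen_ord NF i).
have c_inj : injective c by move=> i j /enum_val_inj/(congr1 val)/= /val_inj.
pose G i : {set F * F} := [set (x, (rVpoly (c i)).[x]) | x : F].
have GE i x y : ((x, y) \in G i) = (y == (rVpoly (c i)).[x]).
  apply/imsetP/eqP => [[x' _ [-> ->]]//|->]; by exists x.
have cardG i : #|G i| = q by rewrite card_imset // => x y [].
have := @leq_zarankiewicz_family 'I_N (F * F)%type G m n t t0.
rewrite card_ord card_prod Fq geq_minl mulnn qn => /(_ isT isT) h.
apply: leq_trans (h _); first by rewrite (eq_bigr _ (fun i _ => cardG i)) sum_nat_const card_ord.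
move=> i j ij; pose P := rVpoly (c i) - rVpoly (c j).
have P0 : P != 0.
  by rewrite subr_eq0 (can_eq rVpolyK) (inj_eq c_inj).
have sP : (size P <= t)%N.
  by rewrite (leq_trans (size_polyD _ _)) // size_polyN geq_max !size_poly.
apply: leq_trans sP; rewrite -(card_in_imset (f := fst)); last first.
  move=> [x y] [x' y']; rewrite !inE !GE /= => /andP[/eqP -> _] /andP[/eqP -> _] ->.
  by [].
apply: card_roots_lt => // x /imsetP[[x' y]]; rewrite inE !GE => /andP[/eqP yi /eqP yj] ->.
by rewrite /root /P hornerD hornerN -yi -yj subrr.
Qed.

Lemma prim_root_neq0 (F : fieldType) n (z : F) : n.-primitive_root z -> z != 0.
Proof.
move=> z_prim; apply/eqP => z0; have := prim_expr_order z_prim.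
rewrite z0 expr0n eqn0Ngt (prim_order_gt0 z_prim) /= => /eqP.
by rewrite eq_sym oner_eq0.
Qed.

(** * The inversive plane of order q *)

Section InversivePlane.
Variables (K : finFieldType) (q : nat).
Hypothesis q_gt1 : (1 < q)%N.
Hypothesis cardK : #|K| = (q ^ 2)%N.
Hypothesis frobD : {morph (fun x : K => x ^+ q) : x y / x + y}.

Let frobB : {morph (fun x : K => x ^+ q) : x y / x - y}.
Proof. by move=> x y; apply: (addIr (y ^+ q)); rewrite -frobD !subrK. Qed.

Let frobK (x : K) : (x ^+ q) ^+ q = x.
Proof. by rewrite -exprM mulnn -cardK expf_card. Qed.

Let frob0 : (0 : K) ^+ q = 0. Proof. by rewrite expr0n; case: (q) q_gt1. Qed.

Let base : {set K} := [set x | x ^+ q == x].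

(** [base] is the subfield F_q. Its elements are roots of X^q - X, hence at most q; conversely the
    trace maps the q^2 elements of [K] into [base] with fibres of size at most q. *)
Lemma card_base : #|base| = q.
Proof.
have q0 : (0 < q)%N by lia.
apply/eqP; rewrite eqn_leq; apply/andP; split.
  have sz : size ('X^q - 'X : {poly K}) = q.+1.
    by rewrite size_polyDl ?size_polyXn // size_polyN size_polyX ltnS.
  rewrite -ltnS -sz; apply: card_roots_lt; first by rewrite -size_poly_gt0 sz.
  by move=> x; rewrite inE => /eqP xq; rewrite /root !hornerE xq subrr.
pose tr (x : K) := x + x ^+ q.
have trB x : tr x \in base by rewrite inE /tr frobD frobK addrC.
rewrite -(leq_pmul2r q0) mulnn -cardK -[leqLHS]sum1_card.
rewrite (partition_big tr (fun e => e \in base)) //= -sum_nat_const.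
apply: leq_sum => e _; rewrite sum1dep_card.
have sz : size ('X^q + ('X - e%:P) : {poly K}) = q.+1.
  by rewrite size_polyDl ?size_polyXn // size_XsubC ltnS.
rewrite -ltnS -sz; apply: card_roots_lt; first by rewrite -size_poly_gt0 sz.
move=> x; rewrite inE => /eqP xe.
by rewrite /root !hornerE /= [_ + x]addrC -/(tr x) xe subrr.
Qed.

Lemma card_quadratic_roots (a b c : K) (A : {set K}) : c != 0 ->
  {in A, forall x, a + b * x + c * x ^+ 2 = 0} -> (#|A| < 3)%N.
Proof.
move=> c0 H; pose P : {poly K} := Poly [:: a; b; c].
have P0 : P != 0.
  by apply: contraNneq c0 => /(congr1 (fun p : {poly K} => p`_2)); rewrite coef_Poly coef0 /= => ->.
apply: leq_trans (size_Poly [:: a; b; c]); apply: card_roots_lt => // x /H xE.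
by rewrite /root horner_Poly /=; apply/eqP; rewrite -[RHS]xE; ring.
Qed.

(** On the line, x^q is an affine function of x. Inserting it into (x - u)(x^q - u^q) = d,
    multiplied by b^q, leaves a quadratic equation with leading coefficient [- b]. *)
Lemma card_circle_line (u d b e : K) (A : {set K}) : b != 0 ->
  {in A, forall x, (x - u) ^+ q.+1 = d /\ b * x + (b * x) ^+ q = e} -> (#|A| < 3)%N.
Proof.
move=> b0 H; pose B := b ^+ q; pose U := u ^+ q.
apply: (@card_quadratic_roots (u * (B * U - e) - d * B) (e - B * U + u * b) (- b)).
  by rewrite oppr_eq0.
move=> x /H[xd xe]; have {}xe : B * x ^+ q = e - b * x.
  by rewrite -xe exprMn [X in X - _]addrC addrK.
have := congr1 ( *%R^~ B) xd; rewrite exprS frobB -/U /= => h.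
have : (x - u) * (B * x ^+ q - B * U) = d * B by rewrite -h; ring.
by rewrite xe => h2; rewrite -[d * B]h2; ring.
Qed.

(* In [option K] the point at infinity is [None]; [x ^+ q] is the conjugate of [x]. *)
Let circle (p : K * {x | x \in base :\ 0}) : {set option K} :=
  [set o | if o is Some x then (x - p.1) ^+ q.+1 == val p.2 else false].

(** For a generator [z] of the multiplicative group of [K], the [z ^+ i] with i <= q represent its
    cosets modulo that of F_q, so no line is listed twice. *)
Let line (z : K) (p : 'I_q.+1 * {x | x \in base}) : {set option K} :=
  [set o | if o is Some x then z ^+ p.1 * x + (z ^+ p.1 * x) ^+ q == val p.2 else true].

Let block (z : K) i := match i with inl p => circle p | inr p => line z p end.

Lemma card_option_set (A : {set option K}) :
  #|A| = ((None \in A) + #|[set x | Some x \in A]|)%N.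
Proof.
have inj_Some : injective (@Some K) by move=> x y [].
rewrite (cardsD1 None); congr (_ + _)%N.
rewrite -(card_imset [set x | Some x \in A] inj_Some).
apply: eq_card => -[x|]; last by rewrite !inE eqxx; apply/esym/imsetP => -[].
rewrite !inE /=; apply/idP/imsetP => [xA|[y]]; first by exists x; rewrite ?inE.
by rewrite inE => yA [->].
Qed.

Lemma leq_sum_card_fibre (A S : {set K}) (f : K -> K) : {in S, forall x, f x \in A} ->
  (#|S| <= \sum_(d : {x | x \in A}) #|[set x | f x == val d]|)%N.
Proof.
move=> fA; rewrite -(big_sub (mem A) (fun d => #|[set x | f x == d]|)).
rewrite -sum1_card (partition_big f (mem A)) //=; apply: leq_sum => d _.
by rewrite sum1dep_card subset_leq_card //; apply/subsetP => x; rewrite !inE => /andP[].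
Qed.

(** Concentric circles are disjoint. Otherwise subtracting the two equations gives a line, and
    [card_circle_line] applies. *)
Let circleI p p' : p != p' -> (#|circle p :&: circle p'| < 3)%N.
Proof.
case: p p' => u d [u' d'] pp'; rewrite card_option_set !inE add0n.
have [uu'|uu'] := eqVneq u u'.
  rewrite (_ : [set x | _] = set0) ?cards0 //; apply/setP => x; rewrite !inE /=.
  rewrite -uu'; apply: contraNF pp' => /andP[/eqP xd /eqP xd'].
  by rewrite uu' xpair_eqE eqxx /= -val_eqE /= -xd -xd'.
pose b := (u' - u) ^+ q.
have b0 : b != 0 by rewrite expf_neq0 // subr_eq0 eq_sym.
apply: (@card_circle_line u (val d) b (val d - val d' - u ^+ q.+1 + u' ^+ q.+1)) => //.
move=> x; rewrite !inE /= => /andP[/eqP xd /eqP xd']; split=> //.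
rewrite exprMn {2}/b frobK -xd -xd' !exprS /b !frobB; ring.
Qed.

Let circle_lineI z p p' : z != 0 -> (#|circle p :&: line z p'| < 3)%N.
Proof.
case: p p' => u d [i e] z0; rewrite card_option_set !inE add0n.
apply: (@card_circle_line u (val d) (z ^+ i) (val e)); first by rewrite expf_neq0.
by move=> x; rewrite !inE /= => /andP[/eqP xd /eqP xe].
Qed.

(** Lines of one direction meet only at infinity. For two directions, common finite points x != y
    would give [z ^+ i] and [z ^+ i'] equal (q-1)-th powers, but the exponents i (q - 1) are
    distinct and below q^2 - 1. *)
Let lineI z p p' : (q ^ 2).-1.-primitive_root z -> p != p' ->
  (#|line z p :&: line z p'| < 3)%N.
Proof.
case: p p' => i e [i' e'] z_prim pp'; rewrite card_option_set !inE add1n !ltnS.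
have [ii'|ii'] := eqVneq i i'.
  rewrite (_ : [set x | _] = set0) ?cards0 //; apply/setP => x; rewrite !inE /=.
  rewrite -ii'; apply: contraNF pp' => /andP[/eqP xd /eqP xd'].
  by rewrite ii' xpair_eqE eqxx /= -val_eqE /= -xd -xd'.
apply/card_le1_eqP => y x; rewrite !inE /= => /andP[/eqP y1 /eqP y2] /andP[/eqP x1 /eqP x2].
apply/eqP; rewrite -subr_eq0; apply: contraNT ii' => xy0.
have root_m1 (w v : K) : w != 0 -> w * x + (w * x) ^+ q = v -> w * y + (w * y) ^+ q = v ->
    w ^+ q.-1 * (x - y) ^+ q.-1 = -1.
  move=> w0 xv yv; have wxy : w * (x - y) != 0 by rewrite mulf_neq0.
  apply: (mulfI wxy); rewrite -exprMn -exprS prednK; last by lia.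
  by apply/eqP; rewrite mulrN1 -addr_eq0 addrC mulrBr frobB addrACA -opprD xv yv subrr.
have z0 := prim_root_neq0 _ _ _ z_prim.
have := root_m1 _ _ (expf_neq0 i z0) x1 y1; rewrite -(root_m1 _ _ (expf_neq0 i' z0) x2 y2).
move/(mulIf (expf_neq0 _ xy0))/eqP; rewrite -!exprM (eq_prim_root_expr z_prim).
have small (j : 'I_q.+1) : (j * q.-1 < (q ^ 2).-1)%N by have := ltn_ord j; nia.
have q1 : (0 < q.-1)%N by lia.
by rewrite !modn_small // eqn_pmul2r.
Qed.

(** There are q^2 (q - 1) circles and (q + 1) q lines. The circles about u cover the q^2 - 1 points
    other than u; the q lines of one direction cover [K] and all contain infinity. This gives q^2
    (q^2 - 1) + (q + 1)(q^2 + q) incidences. *)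
Lemma leq_zarankiewicz_inversive m n : (q ^ 3 + q <= m)%N -> (q ^ 2 + 1 <= n)%N ->
  ((q ^ 2 + q) * (q ^ 2 + 1) <= zarankiewicz m n 2 3)%N.
Proof.
move=> qm qn.
have card_base0 : #|base :\ 0| = q.-1.
  by have := cardsD1 0 base; rewrite inE frob0 eqxx card_base => ->.
have [z z_prim] : exists z : K, (q ^ 2).-1.-primitive_root z.
  have nz : #|[set~ (0 : K)]| = (q ^ 2).-1 by rewrite cardsC1 cardK.
  have /hasP[z _ zP] : has (q ^ 2).-1.-primitive_root (enum [set~ (0 : K)]).
    apply: has_prim_root; rewrite ?enum_uniq -?cardE ?nz //; first by nia.
    apply/allP => x; rewrite mem_enum !inE => x0; rewrite unity_rootE.
    apply/eqP/(mulfI x0); rewrite -exprS prednK; last by rewrite expn_gt0; lia.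
    by rewrite mulr1 -cardK expf_card.
  by exists z.
have z0 := prim_root_neq0 _ _ _ z_prim.
apply: leq_trans (leq_zarankiewicz_family _ _ (block z) m n 3 _ _ _ _) => //; first last.
- move=> [p|p] [p'|p'] pp'; rewrite /block.
  + exact: circleI.
  + exact: circle_lineI.
  + by rewrite setIC; exact: circle_lineI.
  + exact: lineI.
- by rewrite card_option cardK; lia.
- rewrite card_sum !card_prod !card_sig !card_ord cardK.
  rewrite (eq_card (B := base :\ 0)) // card_base0.
  by rewrite [X in (_ + _ * X)%N](eq_card (B := base)) // card_base; nia.
rewrite big_sumType /=.
rewrite -(pair_big predT predT (fun u d => #|circle (u, d)|)).
rewrite -(pair_big predT predT (fun i e => #|line z (i, e)|)) /=.
apply: leq_trans (leq_add (_ : #|K| * (q ^ 2).-1 <= _)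
  (_ : q.+1 * (q ^ 2 + q) <= _))%N; last 2 first.
- rewrite -sum_nat_const; apply: leq_sum => u _.
  apply: leq_trans (leq_trans (leq_sum_card_fibre (base :\ 0) [set~ u]
    (fun x => (x - u) ^+ q.+1) _) _).
  + by rewrite cardsC1 cardK.
  + move=> x; rewrite !inE => xu; rewrite expf_neq0 ?subr_eq0 //=.
    by rewrite exprS exprMn frobK mulrC.
  apply: leq_sum => d _; rewrite card_option_set !inE add0n.
  by apply/subset_leq_card/subsetP => x; rewrite !inE.
- rewrite -[X in (X * _)%N](card_ord q.+1) -sum_nat_const; apply: leq_sum => i _.
  pose f x := z ^+ i * x + (z ^+ i * x) ^+ q.
  apply: leq_trans (_ : \sum_(e : {x | x \in base}) (1 + #|[set x | f x == val e]|) <= _)%N.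
    rewrite big_split /= sum_nat_const muln1 card_sig (eq_card (B := base)) // card_base addnC.
    rewrite leq_add2l; apply: leq_trans (leq_sum_card_fibre base setT f _).
      by rewrite cardsT cardK.
    by move=> x _; rewrite inE /f frobD frobK addrC.
  apply: leq_sum => e _; rewrite card_option_set !inE leq_add2l.
  by apply/subset_leq_card/subsetP => x; rewrite !inE.
rewrite cardK; nia.
Qed.

End InversivePlane.

(** * Prime powers in short intervals *)

From mathcomp Require Import all_classical all_reals all_analysis.
Import numFieldNormedType.Exports.

(** * The von Mangoldt and Moebius functions *)

Section Arithmetic.
Variable R : realType.
Implicit Types (n d k N : nat).

Lemma sum_multiples (V : nmodType) N d (F : nat -> V) : (0 < d)%N ->
  \sum_(1 <= k < N.+1 | (d %| k)%N) F k = \sum_(1 <= j < (N %/ d).+1) F (d * j)%N.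
Proof.
move=> d_gt0; elim: N => [|N IH]; first by rewrite div0n !big_geq.
rewrite big_mkcond big_nat_recr //= -big_mkcond IH divnS //.
case: ifP => dN; last by rewrite addr0 add0n.
rewrite add1n [RHS]big_nat_recr //=; congr (_ + F _).
move/dvdnP: dN => [c Nc]; have := divnS N d_gt0.
by rewrite Nc mulnK // dvdn_mull // add1n mulnC => ->.
Qed.

Definition Lambda n : R := if primes n is [:: p] then ln p%:R else 0.

Lemma Lambda_pfactor p k : prime p -> (0 < k)%N -> Lambda (p ^ k) = ln p%:R.
Proof. by move=> p_pr k_gt0; rewrite /Lambda primesX // primes_prime. Qed.

Lemma Lambda_neq0 n : Lambda n != 0 ->
  exists p k, [/\ prime p, (0 < k)%N & n = (p ^ k)%N].
Proof.
rewrite /Lambda; case E : (primes n) => [|p [|? ?]]; rewrite ?eqxx // => _.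
have p_n : p \in primes n by rewrite E inE.
exists p, (logn p n); move: (p_n); rewrite mem_primes => /and3P[p_pr n_gt0 p_dv].
split=> //; first by rewrite logn_gt0.
by rewrite {1}(prod_prime_decomp n_gt0) prime_decompE E /= big_seq1.
Qed.

Lemma Lambda_ge0 n : 0 <= Lambda n.
Proof.
rewrite /Lambda; case E : (primes n) => [|p [|? ?]] //.
have : p \in primes n by rewrite E inE.
by rewrite mem_primes => /and3P[/prime_gt0 p_gt0 _ _]; rewrite ln_ge0 // ler1n.
Qed.

Lemma Lambda1 : Lambda 1 = 0. Proof. by []. Qed.

(** Induction along n = p m, p the least prime divisor: the only prime power dividing n but not m is
    p^v, v the exponent of p in n. The range [N] does not depend on [n], so that such sums can be
    exchanged. *)
Lemma sum_Lambda_dvdn N n : (0 < n <= N)%N ->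
  \sum_(1 <= d < N.+1 | (d %| n)%N) Lambda d = ln n%:R.
Proof.
have [k] := ubnP n; elim: k n => // k IH n /ltnSE le_nk /andP[n_gt0 le_nN].
have [n1|n_gt1] := leqP n 1.
  have -> : n = 1%N by lia.
  rewrite ln1 big_mkcond /= big1_seq // => d.
  by case: ifP => //; rewrite dvdn1 => /eqP -> _; rewrite Lambda1.
set p := pdiv n; have p_pr : prime p by apply: pdiv_prime.
have p_gt1 := prime_gt1 p_pr.
have [m nE] := dvdnP (pdiv_dvd n); rewrite -/p in nE.
have m_gt0 : (0 < m)%N by move: n_gt0; rewrite nE; case: (m).
have m_lt : (m < n)%N by rewrite nE ltn_Pmulr.
rewrite (bigID (fun d => d %| m)%N) /=.
rewrite (eq_bigl (fun d => d %| m)%N); last first.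
  by move=> d; apply: andb_idl => dm; rewrite nE dvdn_mulr.
rewrite IH; [|by lia..].
pose v := logn p n.
have v_gt0 : (0 < v)%N by rewrite logn_gt0 mem_primes p_pr n_gt0 pdiv_dvd.
have logm : logn p m = v.-1.
  by rewrite /v nE lognM ?(prime_gt0 p_pr) // (logn_prime _ p_pr) eqxx addn1.
rewrite big_mkcond (bigD1_seq (p ^ v)%N) ?iota_uniq //=; last first.
  rewrite mem_index_iota expn_gt0 prime_gt0 //= ltnS.
  by apply: leq_trans le_nN; apply: dvdn_leq => //; rewrite pfactor_dvdnn.
rewrite pfactor_dvdnn pfactor_dvdn // logm.
have -> : (v <= v.-1)%N = false by lia.
rewrite /= Lambda_pfactor // big1_seq ?addr0; last first.
  move=> d /andP[d_ne _]; case: ifP => // /andP[dn dm].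
  apply/eqP/negPn/negP => /Lambda_neq0[r [j [r_pr j_gt0 dE]]].
  have [rp|r_ne] := eqVneq r p.
    move: dn dm d_ne; rewrite dE rp !pfactor_dvdn // logm -/v => jv jv' /eqP[].
    by have -> : j = v by lia.
  have cop : coprime d p by rewrite dE coprimeXl // prime_coprime // dvdn_prime2.
  by move: dm; rewrite -(Gauss_dvdl m cop) -nE dn.
by rewrite nE natrM lnM ?posrE ?ltr0n // prime_gt0.
Qed.

Definition mobius n : R := \prod_(p <- primes n) (if logn p n == 1%N then -1 else 0).

Lemma mobius1 : mobius 1 = 1. Proof. by rewrite /mobius big_nil. Qed.

Lemma norm_mobius n : `|mobius n| <= 1.
Proof.
rewrite /mobius; elim/big_rec: _ => [|p x _ x1]; first by rewrite normr1.
by rewrite normrM; case: ifP => _; rewrite ?normrN1 ?normr0 ?mul1r ?mul0r.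
Qed.

Lemma mobius_prime_mul p j : prime p -> (0 < j)%N ->
  mobius (p * j) = if (p %| j)%N then 0 else - mobius j.
Proof.
move=> p_pr j_gt0; have p_gt0 := prime_gt0 p_pr.
have p_in : p \in primes (p * j).
  by rewrite mem_primes p_pr muln_gt0 p_gt0 j_gt0 dvdn_mulr.
have logp : logn p (p * j) = (logn p j).+1 by rewrite lognM // (logn_prime _ p_pr) eqxx.
case: ifP => pj.
  rewrite /mobius (bigD1_seq p) ?primes_uniq //= logp.
  have -> : logn p j = (logn p j).-1.+1 by rewrite prednK // logn_gt0 mem_primes p_pr j_gt0.
  by rewrite mul0r.
have pj0 : logn p j = 0%N.
  by apply/eqP; rewrite -leqn0 leqNgt logn_gt0 mem_primes p_pr j_gt0 pj.
have pe : perm_eq (primes (p * j)) (p :: primes j).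
  apply: uniq_perm; rewrite /= ?primes_uniq ?mem_primes ?pj ?andbF //.
  by move=> q; rewrite primesM // inE primes_prime // inE.
rewrite /mobius (perm_big _ pe) /= big_cons logp pj0 eqxx mulN1r; congr (- _).
apply: eq_big_seq => q; rewrite mem_primes => /and3P[q_pr _ qj].
rewrite lognM // (logn_prime _ p_pr); case: (eqVneq q p) => // pq.
by move: pj; rewrite -pq qj.
Qed.

(** With p the least prime divisor of n, each divisor d prime to p cancels against p d. *)
Lemma sum_mobius_dvdn N n : (1 < n <= N)%N ->
  \sum_(1 <= d < N.+1 | (d %| n)%N) mobius d = 0.
Proof.
move=> /andP[n_gt1 le_nN]; have n_gt0 := ltnW n_gt1.
set p := pdiv n; have p_pr : prime p by apply: pdiv_prime.
have p_gt0 := prime_gt0 p_pr.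
rewrite (bigID (fun d => p %| d)%N) /=.
under eq_bigl do rewrite andbC.
rewrite big_mkcondr /= sum_multiples //.
(* A divisor d prime to p has d p <= n <= N, so the sum over such d may stop at N / p, the range of
   the other sum. *)
rewrite (big_cat_nat _ (n := (N %/ p).+1) (m := 1) (p := N.+1)) //=; last first.
  by rewrite ltnS leq_div.
rewrite [X in _ + (_ + X)]big1_seq ?addr0; last first.
  move=> d; rewrite mem_index_iota => /andP[/andP[dn pd] /andP[lo _]].
  have : (d * p %| n)%N by rewrite Gauss_dvd ?dn ?pdiv_dvd // coprime_sym prime_coprime.
  by move/(dvdn_leq n_gt0) => h; move: lo; rewrite ltnNge leq_divRL //; lia.
rewrite [X in _ + X]big_mkcond -big_split /= big1_seq // => j.
rewrite mem_index_iota => /andP[_ /andP[j_gt0 _]].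
rewrite mobius_prime_mul //; have [pj|pj] := boolP (p %| j)%N.
  by rewrite andbF if_same addr0.
rewrite andbT Gauss_dvd ?prime_coprime // pdiv_dvd /=.
by case: ifP; rewrite ?addr0 ?addNr.
Qed.

(** Expand ln(k/d) as the sum of [Lambda] over the divisors e of k/d and exchange: the sum of
    [mobius] over the divisors of k/e vanishes unless e = k. *)
Lemma sum_mobius_ln N k : (0 < k <= N)%N ->
  \sum_(1 <= d < N.+1 | (d %| k)%N) mobius d * (ln k%:R - ln d%:R) = Lambda k.
Proof.
move=> /andP[k_gt0 le_kN].
transitivity (\sum_(1 <= d < N.+1) \sum_(1 <= e < N.+1 | (d * e %| k)%N)
    mobius d * Lambda e).
  rewrite big_mkcond; apply: eq_big_seq => d; rewrite mem_index_iota => /andP[d_gt0 _].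
  case: ifP => dk; last first.
    rewrite big_pred0 // => e; apply/negP => h.
    by move: dk; rewrite (dvdn_trans _ h) // dvdn_mulr.
  rewrite -big_distrr /=; congr (_ * _).
  rewrite -ln_div ?posrE ?ltr0n //.
  have -> : k%:R / d%:R = (k %/ d)%N%:R :> R.
    by rewrite -{1}(divnK dk) natrM mulfK // pnatr_eq0 -lt0n.
  have kd : (0 < k %/ d <= N)%N.
    by rewrite divn_gt0 // (dvdn_leq k_gt0 dk) (leq_trans (leq_div _ _)).
  rewrite -(sum_Lambda_dvdn N (k %/ d) kd).
  by apply: eq_bigl => e; rewrite dvdn_divRL // mulnC.
under eq_bigr do rewrite big_mkcond.
rewrite exchange_big /=.
rewrite (bigD1_seq k) ?iota_uniq ?mem_index_iota ?k_gt0 //=.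
rewrite [X in _ + X]big1_seq ?addr0; last first.
  move=> e /andP[ek]; rewrite mem_index_iota => /andP[e_gt0 _].
  rewrite -big_mkcond /= -big_distrl /=.
  have [edv|edv] := boolP (e %| k)%N; last first.
    rewrite big_pred0 ?mul0r // => d; apply/negP => h.
    by move/negP: edv; apply; rewrite (dvdn_trans _ h) // dvdn_mull.
  rewrite (eq_bigl (fun d => d %| k %/ e)%N); last by move=> d; rewrite dvdn_divRL.
  rewrite sum_mobius_dvdn ?mul0r // (leq_trans (leq_div _ _)) // andbT.
  have : (k %/ e != 1)%N by apply: contraNneq ek => h; rewrite -(divnK edv) h mul1n.
  have : (0 < k %/ e)%N by rewrite divn_gt0 // dvdn_leq.
  lia.
rewrite (bigD1_seq 1%N) ?iota_uniq ?mem_index_iota //=; last by lia.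
rewrite mul1n dvdnn mobius1 mul1r big1_seq ?addr0 // => d /andP[d1].
rewrite mem_index_iota => /andP[d_gt0 _]; case: ifP => // h.
have dk := dvdn_leq k_gt0 h.
have : (1 < d)%N by lia.
by rewrite -(ltn_pmul2r k_gt0) mul1n ltnNge dk.
Qed.

End Arithmetic.

(** * Chebyshev and Mertens bounds *)

Section Chebyshev.
Variable R : realType.
Implicit Types (n d k N M : nat).
Local Notation L := (Lambda R).

Lemma ln_le_sub1 (x : R) : 0 < x -> ln x <= x - 1.
Proof. by move=> x0; have := @le_ln1Dx R (x - 1); rewrite [1 + _]addrC subrK; apply; lra. Qed.

Lemma ln_div_le (x y : R) : 0 < x -> 0 < y -> ln x - ln y <= (x - y) / y.
Proof.
move=> x0 y0; rewrite -ln_div ?posrE // mulrBl divff ?gt_eqF //.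
by rewrite ln_le_sub1 // divr_gt0.
Qed.

(** Since 2 <= (9/8)^6 and ln(9/8) <= 1/8. The bound must be this good for [psi_le] to stay clearly
    below 2. *)
Lemma ln2_le : ln (2 : R) <= 3 / 4.
Proof.
have h : ln (9 / 8 : R) <= 1 / 8.
  by apply: le_trans (ln_le_sub1 _ _) _; lra.
have : ln (2 : R) <= ln ((9 / 8) ^+ 6) by rewrite ler_ln ?posrE; nra.
by rewrite lnXn; lra.
Qed.

Lemma ln2_ge : 1 / 2 <= ln (2 : R).
Proof. by have := @ln_div_le 1 2; rewrite ln1 => /(_ ltr01 (ltr0Sn _ _)); lra. Qed.

Lemma ln_natM (m n : nat) : (0 < m)%N -> (0 < n)%N ->
  ln (m * n)%N%:R = ln m%:R + ln n%:R :> R.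
Proof. by move=> m0 n0; rewrite natrM lnM // posrE ltr0n. Qed.

Lemma ln_fact N : ln N`!%:R = \sum_(1 <= k < N.+1) ln k%:R :> R.
Proof.
elim: N => [|N IH]; first by rewrite big_geq // fact0 ln1.
by rewrite big_nat_recr //= -IH factS mulnC ln_natM // fact_gt0.
Qed.

Lemma sum_divn_exchange (V : nmodType) N (F : nat -> nat -> V) :
  \sum_(1 <= d < N.+1) \sum_(1 <= j < (N %/ d).+1) F d j =
  \sum_(1 <= j < N.+1) \sum_(1 <= d < (N %/ j).+1) F d j.
Proof.
have E (G : nat -> nat -> V) :
    \sum_(1 <= d < N.+1) \sum_(1 <= j < (N %/ d).+1) G d j =
    \sum_(1 <= d < N.+1) \sum_(1 <= j < N.+1 | (d * j <= N)%N) G d j.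
  apply: eq_big_seq => d; rewrite mem_index_iota => /andP[d0 dN].
  rewrite (big_nat_widen _ _ N.+1) ?ltnS ?leq_div //.
  by apply: eq_bigl => j; rewrite ltnS leq_divRL // mulnC.
rewrite E (E (fun j d => F d j)).
under eq_bigr do rewrite big_mkcond.
rewrite exchange_big /=; apply: eq_bigr => j _; rewrite -big_mkcond.
by apply: eq_bigl => d; rewrite mulnC.
Qed.

Lemma sum_divn_dvdn N (a f : nat -> R) :
  \sum_(1 <= d < N.+1) a d * (\sum_(1 <= j < (N %/ d).+1) f (d * j)%N) =
  \sum_(1 <= k < N.+1) f k * \sum_(1 <= d < N.+1 | (d %| k)%N) a d.
Proof.
under [RHS]eq_bigr do rewrite big_distrr big_mkcond.
rewrite exchange_big /=; apply: eq_big_seq => d; rewrite mem_index_iota => /andP[d0 dN].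
rewrite -big_mkcond sum_multiples // big_distrr /=.
by apply: eq_bigr => j _; rewrite mulrC.
Qed.

Definition psi N : R := \sum_(1 <= k < N.+1) L k.

Lemma psi0 : psi 0 = 0. Proof. by rewrite /psi big_geq. Qed.

Lemma psiS N : psi N.+1 = psi N + L N.+1. Proof. by rewrite /psi big_nat_recr. Qed.

Lemma le_psi M N : (M <= N)%N -> psi M <= psi N.
Proof.
move=> MN; rewrite /psi (big_cat_nat _ (n := M.+1) (p := N.+1)) //= lerDl.
by apply: sumr_ge0 => k _; apply: Lambda_ge0.
Qed.

Lemma psi_ge0 N : 0 <= psi N.
Proof. by rewrite -psi0 le_psi. Qed.

Lemma Lambda_le_ln n : (0 < n)%N -> L n <= ln n%:R.
Proof.
move=> n0; rewrite -(sum_Lambda_dvdn _ n n) ?n0 //=.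
rewrite big_mkcond (bigD1_seq n) ?iota_uniq ?mem_index_iota ?n0 ?ltnSn //= dvdnn lerDl.
by apply: sumr_ge0 => k _; case: ifP => // _; apply: Lambda_ge0.
Qed.

Lemma sum_Lambda_divn N :
  \sum_(1 <= d < N.+1) L d * (N %/ d)%N%:R = ln N`!%:R.
Proof.
rewrite ln_fact; have := sum_divn_dvdn N L (fun=> 1).
rewrite (eq_bigr (fun d => L d * (N %/ d)%N%:R)); last first.
  by move=> d _; rewrite big_const_nat subn1 iter_addr_0.
move=> ->; apply: eq_big_seq => k; rewrite mem_index_iota => /andP[k0 kN].
by rewrite mul1r sum_Lambda_dvdn // k0.
Qed.

Lemma sum_psi_divn N : \sum_(1 <= k < N.+1) psi (N %/ k) = ln N`!%:R.
Proof.
rewrite sum_divn_exchange -sum_Lambda_divn; apply: eq_bigr => d _.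
by rewrite big_const_nat subn1 iter_addr_0 mulr_natr.
Qed.

Lemma bin_le_exp2 n m : ('C(n, m) <= 2 ^ n)%N.
Proof.
have [le_mn|lt_nm] := leqP m n; last by rewrite bin_small.
rewrite -[2%N]/(1 + 1)%N expnDn (bigD1 (inord m)) //= inordK // !exp1n !muln1.
exact: leq_addr.
Qed.

(** In the logarithm of the central binomial coefficient, [Lambda d] has weight floor(2M/d) - 2
    floor(M/d), which is nonnegative, and at least 1 for M < d <= 2M. *)
Lemma psi_double M : psi (M + M) - psi M <= ln 2 *+ (M + M).
Proof.
have lnbin : ln 'C(M + M, M)%:R = ln (M + M)`!%:R - ln M`!%:R *+ 2 :> R.
  rewrite -(@bin_fact (M + M) M) ?leq_addr // addnK.
  rewrite !ln_natM ?muln_gt0 ?fact_gt0 ?bin_gt0 ?leq_addr // mulr2n; ring.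
rewrite -lnXn // -natrX; apply: le_trans (_ : ln 'C(M + M, M)%:R <= _); last first.
  by rewrite ler_ln ?posrE ?ltr0n ?expn_gt0 ?bin_gt0 ?leq_addr // ler_nat bin_le_exp2.
have M2 : \sum_(1 <= d < (M + M).+1) L d * (M %/ d)%N%:R = ln M`!%:R.
  rewrite -sum_Lambda_divn (big_cat_nat _ (n := M.+1) (p := (M + M).+1)) //=; last first.
    by rewrite ltnS leq_addr.
  rewrite [X in _ + X]big1_seq ?addr0 // => d; rewrite mem_index_iota => /andP[_ /andP[Md _]].
  by rewrite divn_small ?mulr0.
rewrite lnbin -M2 -sum_Lambda_divn mulr2n opprD addrA -!sumrB.
rewrite [X in _ <= X](big_cat_nat _ (n := M.+1) (p := (M + M).+1)) //=; last first.
  by rewrite ltnS leq_addr.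
rewrite {1}/psi (big_cat_nat _ (n := M.+1) (p := (M + M).+1)) //=; last first.
  by rewrite ltnS leq_addr.
rewrite -/(psi M) addrAC subrr add0r ler_wpDl //.
  apply: sumr_ge0 => d _; rewrite -!mulrBr mulr_ge0 ?Lambda_ge0 //.
  rewrite -addrA -opprD -natrD subr_ge0 ler_nat.
  have [->|d0] := posnP d; first by rewrite !divn0.
  by rewrite leq_divRL // mulnDl leq_add // leq_divM.
rewrite big_seq [X in _ <= X]big_seq; apply: ler_sum => d.
rewrite mem_index_iota => /andP[Md dMM].
rewrite (divn_small Md) !mulr0 !subr0 ler_peMr ?Lambda_ge0 // ler1n divn_gt0; lia.
Qed.

(** Induction from N/2 to N. The constant has to stay below the density 39/20 reached by the chain
    in [window_absurd]. *)
Lemma psi_le N : psi N <= 7 / 4 * N%:R.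
Proof.
have [k] := ubnP N; elim: k N => // k IH N /ltnSE le_Nk.
have [N0|N0] := posnP N; first by rewrite N0 psi0 mulr0.
have IHM : psi N./2 <= 7 / 4 * N./2%:R.
  by apply: IH; have := odd_double_half N; case: (odd N) => /=; lia.
have hd := psi_double N./2; have l2 := ln2_le.
have l2M : ln (2 : R) *+ (N./2 + N./2) <= 3 / 2 * N./2%:R.
  rewrite -[_ *+ (_ + _)]mulr_natr natrD; have : 0 <= N./2%:R :> R by rewrite ler0n.
  nra.
have M0 : 0 <= N./2%:R :> R by rewrite ler0n.
have [NE|NE] : N = (N./2 + N./2)%N \/ N = (N./2 + N./2).+1 by lia.
  have NR : N%:R = N./2%:R + N./2%:R :> R by rewrite -natrD -NE.
  rewrite -NE in hd l2M; lra.
have psiN : psi N = psi (N./2 + N./2) + L N by rewrite {1 4}NE psiS.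
have LN := Lambda_le_ln N N0.
have NR : N%:R = 1 + N./2%:R + N./2%:R :> R by rewrite {1}NE -add1n !natrD addrA.
(* For odd N the slack available for ln N is (N - 1)/8 + 7/4; the tangent of ln at 8 has the same
   slope 1/8. *)
have : ln N%:R - ln (2 ^+ 3) <= (N%:R - 2 ^+ 3) / 2 ^+ 3 :> R.
  by apply: ln_div_le; rewrite ?ltr0n // exprn_gt0.
rewrite lnXn // NR.
move: hd IHM l2M LN psiN; rewrite NR; lra.
Qed.

Lemma lnS_sub_le n : (0 < n)%N -> ln n.+1%:R - ln n%:R <= n%:R^-1 :> R.
Proof.
move=> n0; apply: le_trans (ln_div_le _ _ _ _) _; rewrite ?ltr0n //.
by rewrite -natr1 addrAC subrr add0r mul1r.
Qed.

Lemma lnS_sub_ge n : (0 < n)%N -> n.+1%:R^-1 <= ln n.+1%:R - ln n%:R :> R.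
Proof.
move=> n0; have : ln n%:R - ln n.+1%:R <= (n%:R - n.+1%:R) / n.+1%:R :> R.
  by apply: ln_div_le; rewrite ltr0n.
by rewrite -natr1 opprD addrA subrr add0r mulN1r; lra.
Qed.

Lemma ln_fact_ge N : N%:R * ln N%:R - N%:R <= ln N`!%:R :> R.
Proof.
elim: N => [|N IH]; first by rewrite fact0 ln1 mul0r subrr.
rewrite factS ln_natM ?fact_gt0 //.
have [->|N0] := posnP N; first by rewrite fact0 !ln1; lra.
have := lnS_sub_le N N0; have NR : 0 < N%:R :> R by rewrite ltr0n.
rewrite -(ler_pM2l NR) mulfV ?gt_eqF // -natr1; nra.
Qed.

Lemma ln_fact_le N : (0 < N)%N ->
  ln N`!%:R <= N%:R * ln N%:R - N%:R + 1 + ln N%:R :> R.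
Proof.
elim: N => [//|N IH] _; rewrite factS ln_natM ?fact_gt0 //.
have [->|N0] := posnP N; first by rewrite fact0 !ln1; lra.
have := IH N0.
have := lnS_sub_ge N N0; have NR : 0 < N.+1%:R :> R by rewrite ltr0n.
rewrite -(ler_pM2l NR) mulfV ?gt_eqF // -natr1; nra.
Qed.

Definition mertens N : R := \sum_(1 <= k < N.+1) L k / k%:R.

Lemma natr_divn_le N d : (N %/ d)%N%:R <= N%:R / d%:R :> R.
Proof.
have [->|d0] := posnP d; first by rewrite divn0 invr0 mulr0.
by rewrite ler_pdivlMr ?ltr0n // -natrM ler_nat leq_divM.
Qed.

Lemma natr_divn_gt N d : (0 < d)%N -> N%:R / d%:R < (N %/ d)%N%:R + 1 :> R.
Proof.
by move=> d0; rewrite ltr_pdivrMr ?ltr0n // natr1 -natrM ltr_nat ltn_ceil.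
Qed.

Lemma mertens_ge N : (0 < N)%N -> ln N%:R - 1 <= mertens N.
Proof.
move=> N0; have NR : 0 < N%:R :> R by rewrite ltr0n.
rewrite -(ler_pM2l NR); have := ln_fact_ge N; rewrite -sum_Lambda_divn => h.
apply: le_trans (_ : _ <= _) (_ : \sum_(1 <= d < N.+1) L d * (N %/ d)%N%:R <= _); first by lra.
rewrite /mertens big_distrr /=; apply: ler_sum => d _.
by rewrite mulrCA ler_wpM2l ?Lambda_ge0 // natr_divn_le.
Qed.

(** In ln N! = sum of Lambda(d) floor(N/d), dropping the floors costs at most Lambda(d) per term,
    [psi N] in total. *)
Lemma mertens_le N : (0 < N)%N -> mertens N <= ln N%:R + 4.
Proof.
move=> N0; have NR : 0 < N%:R :> R by rewrite ltr0n.
have NR1 : 1 <= N%:R :> R by rewrite ler1n.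
rewrite -(ler_pM2l NR); have := ln_fact_le N N0; rewrite -sum_Lambda_divn => h.
have lnN := ln_le_sub1 N%:R NR; have psiN := psi_le N.
apply: le_trans (_ : \sum_(1 <= d < N.+1) L d * (N %/ d)%N%:R + psi N <= _); last by lra.
rewrite /mertens /psi big_distrr /= -big_split /=; rewrite big_seq [X in _ <= X]big_seq.
apply: ler_sum => d; rewrite mem_index_iota => /andP[d0 _].
by rewrite mulrCA -{3}[L d]mulr1 -mulrDr ler_wpM2l ?Lambda_ge0 // ltW // natr_divn_gt.
Qed.

End Chebyshev.

(** * Selberg's symmetry formula *)

Section Selberg.
Variable R : realType.
Implicit Types (n d k N M : nat).
Local Notation L := (Lambda R).
Local Notation psi := (psi R).

Definition harmonic_sum n : R := \sum_(1 <= k < n.+1) k%:R^-1.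

Lemma harmonic_sumS n : harmonic_sum n.+1 = harmonic_sum n + n.+1%:R^-1.
Proof. by rewrite /harmonic_sum big_nat_recr. Qed.

(** H_n - ln n decreases, H_n - ln(n+1) increases, and their difference is at most 1/n. *)
Lemma euler_constant : exists g : R, forall n, (0 < n)%N ->
  `|harmonic_sum n - ln n%:R - g| <= n%:R^-1.
Proof.
pose u n := harmonic_sum n - ln n%:R; pose v n := harmonic_sum n - ln n.+1%:R.
have u_decr n m : (0 < n)%N -> (n <= m)%N -> u m <= u n.
  move=> n0; elim: m => [|m IH]; first by lia.
  rewrite leq_eqVlt => /predU1P[-> //|nm]; apply: le_trans (IH nm).
  have m0 : (0 < m)%N by lia.
  by have := @lnS_sub_ge R m m0; rewrite /u harmonic_sumS; set a := _^-1; lra.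
have v_incr n m : (n <= m)%N -> v n <= v m.
  elim: m => [|m IH]; first by rewrite leqn0 => /eqP ->.
  rewrite leq_eqVlt => /predU1P[-> //|nm]; apply: le_trans (IH nm) _.
  by have := @lnS_sub_le R m.+1 isT; rewrite /v harmonic_sumS; set a := _^-1; lra.
have v_le_u n m : (0 < m)%N -> v n <= u m.
  move=> m0; apply: le_trans (v_incr n (maxn n m) (leq_maxl _ _)) _.
  apply: le_trans (u_decr m (maxn n m) m0 (leq_maxr _ _)).
  rewrite /v /u lerD2l lerN2 ler_ln ?posrE ?ltr0n ?ler_nat //.
  by rewrite (leq_trans m0) ?leq_maxr.
have ub m : (0 < m)%N -> ubound (range v) (u m).
  by move=> m0 _ [n _ <-]; apply: v_le_u.
exists (sup (range v)) => n n0.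
have lo : v n <= sup (range v).
  by apply: ub_le_sup; [exists (u 1%N); apply: ub | exists n].
have hi : sup (range v) <= u n by apply: ge_sup; [exists (v 0%N), 0%N | apply: ub].
have := @lnS_sub_le R n n0; rewrite ler_norml; move: lo hi; rewrite /u /v; lra.
Qed.

Lemma sum_invsqrt_le N : \sum_(1 <= d < N.+1) (Num.sqrt d%:R)^-1 <= 2 * Num.sqrt N%:R :> R.
Proof.
elim: N => [|N IH]; first by rewrite big_geq // sqrtr0 mulr0.
rewrite big_nat_recr //=; set a := Num.sqrt N%:R in IH *; set b := Num.sqrt _.
have b2 : b ^+ 2 = a ^+ 2 + 1 by rewrite !sqr_sqrtr ?ler0n // natr1.
have b0 : 0 < b by rewrite sqrtr_gt0 ltr0n.
have a0 : 0 <= a by rewrite sqrtr_ge0.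
suff : b^-1 <= 2 * (b - a) by lra.
rewrite -(ler_pM2l b0) mulfV ?gt_eqF //; nra.
Qed.

(** In [selberg] the errors ln(N/d) (1 + ln(N/d)) are thus dominated by sqrt(N/d), whose sum over d
    is at most 2N by [sum_invsqrt_le]. *)
Lemma sqr_ln_le (y : R) : 1 <= y -> (1 + ln y) ^+ 2 <= 16 * Num.sqrt y.
Proof.
move=> y1; set s := Num.sqrt (Num.sqrt y).
have s0 : 0 < s by rewrite !sqrtr_gt0; lra.
have yE : y = s ^+ 4.
  by rewrite (exprM s 2 2) sqr_sqrtr ?sqrtr_ge0 // sqr_sqrtr; lra.
have -> : Num.sqrt y = s ^+ 2 by rewrite sqr_sqrtr ?sqrtr_ge0.
have ly0 : 0 <= ln y by rewrite ln_ge0.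
have : ln y <= 4 * (s - 1).
  by rewrite yE lnXn // -[ln s *+ 4]mulr_natl; have := @ln_le_sub1 R s s0; lra.
rewrite (_ : 16 * s ^+ 2 = (4 * s) ^+ 2); last by ring.
by move=> h; rewrite lerXn2r ?nnegrE; lra.
Qed.

(** Split ln(N/d) = ln(k/d) + ln(N/k); the second part multiplies the sum of [mobius] over the
    divisors of k. *)
Lemma sum_mobius_lnN N k : (0 < k <= N)%N ->
  \sum_(1 <= d < N.+1 | (d %| k)%N) mobius R d * (ln N%:R - ln d%:R) =
  L k + (if k == 1%N then ln N%:R else 0).
Proof.
move=> kN; rewrite -(sum_mobius_ln R N k kN).
rewrite [X in X = _](_ : _ =
    \sum_(1 <= d < N.+1 | (d %| k)%N) mobius R d * (ln k%:R - ln d%:R) +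
    (\sum_(1 <= d < N.+1 | (d %| k)%N) mobius R d) * (ln N%:R - ln k%:R)).
  congr (_ + _); case: eqP => [k1|k1]; last first.
    by rewrite sum_mobius_dvdn ?mul0r //; lia.
  rewrite k1 ln1 subr0 big_mkcond (bigD1_seq 1%N) ?iota_uniq ?mem_index_iota //=; last by lia.
  rewrite mobius1 big1 ?addr0 ?mul1r // => d d1.
  by rewrite dvdn1 (negPf d1).
by rewrite big_distrl -big_split /=; apply: eq_bigr => d _; ring.
Qed.

(* Tatuzawa and Iseki: for every f,
   sum_d mu(d) ln(N/d) sum_(j <= N/d) f(d j) = f(1) ln N + sum_k Lambda(k) f(k).
   For f(k) = psi(N/k) - N/k + g + 1, with g Euler's constant, the inner sums are
   O(1 + ln(N/d)), so the left-hand side is O(N). *)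
Theorem selberg : exists C : R, 0 <= C /\ forall N, (0 < N)%N ->
  `|psi N * ln N%:R + \sum_(1 <= k < N.+1) L k * psi (N %/ k) -
    2 * N%:R * ln N%:R| <= C * N%:R.
Proof.
have [g gP] := euler_constant.
exists (32 * (3 + `|g|) + 4 + 3 * `|g + 1|); split.
  by have := normr_ge0 g; have := normr_ge0 (g + 1); lra.
move=> N N0; pose f k : R := psi (N %/ k) - N%:R / k%:R + (g + 1).
have NR : 0 < N%:R :> R by rewrite ltr0n.
have NR1 : 1 <= N%:R :> R by rewrite ler1n.
have lnN0 : 0 <= ln N%:R :> R by rewrite ln_ge0.
have fsum d : (0 < d <= N)%N ->
    `|\sum_(1 <= j < (N %/ d).+1) f (d * j)%N| <=
    (3 + `|g|) * (1 + ln (N %/ d)%N%:R).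
  move=> /andP[d0 dN]; set M := (N %/ d)%N; set y : R := N%:R / d%:R.
  have M0 : (0 < M)%N by rewrite divn_gt0.
  have -> : \sum_(1 <= j < M.+1) f (d * j)%N =
      ln M`!%:R - y * harmonic_sum M + (g + 1) * M%:R.
    rewrite /f big_split sumrB /= big_const_nat subn1 iter_addr_0 mulr_natr.
    congr (_ - _ + _).
      by rewrite -sum_psi_divn; apply: eq_bigr => j _; rewrite divnMA.
    rewrite /harmonic_sum big_distrr /=; apply: eq_bigr => j _.
    by rewrite natrM invfM mulrA.
  have MR : 0 < M%:R :> R by rewrite ltr0n.
  have lnM0 : 0 <= ln M%:R :> R by rewrite ln_ge0 // ler1n.
  have e1lo := @ln_fact_ge R M; have e1hi := @ln_fact_le R M M0.
  have e3lo : M%:R <= y by apply: natr_divn_le.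
  have e3hi : y < M%:R + 1 by apply: natr_divn_gt.
  set e2 := harmonic_sum M - ln M%:R - g.
  have e2le : `|e2| * M%:R <= 1.
    by rewrite -ler_pdivlMr // mul1r; apply: gP.
  have -> : harmonic_sum M = e2 + ln M%:R + g by rewrite /e2; lra.
  have ye2 : `|y * e2| <= 2.
    have M1 : 1 <= M%:R :> R by rewrite ler1n.
    rewrite normrM (ger0_norm (_ : 0 <= y)); last by lra.
    by have := normr_ge0 e2; nra.
  have yg : `|(M%:R - y) * (ln M%:R + g)| <= ln M%:R + `|g|.
    rewrite normrM -[X in _ <= X]mul1r ler_pM //.
      by rewrite ler_norml; lra.
    by rewrite (le_trans (ler_normD _ _)) // ger0_norm.
  (* The constant g + 1 in [f] makes the terms M ln M, M and g M cancel; what remains is small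
     because y - M lies in [0, 1). *)
  rewrite (_ : _ + _ = (ln M`!%:R - (M%:R * ln M%:R - M%:R)) - y * e2 +
     (M%:R - y) * (ln M%:R + g)); last by ring.
  apply: le_trans (ler_normD _ _) _; apply: le_trans (lerD (ler_normB _ _) yg) _.
  rewrite [`|ln _ - _|]ger0_norm; last by lra.
  have := normr_ge0 g; nra.
have main : `|\sum_(1 <= d < N.+1) mobius R d * (ln N%:R - ln d%:R) *
    \sum_(1 <= j < (N %/ d).+1) f (d * j)%N| <= 32 * (3 + `|g|) * N%:R.
  apply: le_trans (ler_norm_sum _ _ _) _.
  apply: le_trans (_ : \sum_(1 <= d < N.+1)
     16 * (3 + `|g|) * Num.sqrt N%:R * (Num.sqrt d%:R)^-1 <= _).
    rewrite big_seq [X in _ <= X]big_seq; apply: ler_sum => d.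
    rewrite mem_index_iota ltnS => dN; have /andP[d0 dN'] := dN.
    have dR : 0 < d%:R :> R by rewrite ltr0n.
    have y1 : 1 <= N%:R / d%:R :> R by rewrite ler_pdivlMr // mul1r ler_nat.
    rewrite !normrM -ln_div ?posrE // (ger0_norm (ln_ge0 y1)).
    have lnM : 0 <= ln ((N %/ d)%N%:R : R) <= ln (N%:R / d%:R : R).
      apply/andP; split; first by rewrite ln_ge0 ?ler1n ?divn_gt0.
      rewrite ler_ln ?posrE ?natr_divn_le //.
        by rewrite ltr0n divn_gt0.
      by apply: lt_le_trans y1.
    have mu1 := norm_mobius R d; have mu0 := normr_ge0 (mobius R d).
    have := sqr_ln_le _ y1; rewrite sqrtrM ?ler0n // sqrtrV ?ler0n //.
    have := fsum d dN; set S := `|\sum_(_ <= j < _) _|.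
    set l := ln (N%:R / d%:R) in lnM *; set sN := Num.sqrt N%:R.
    set sd := (Num.sqrt _)^-1 => hS hl.
    have C0 : 0 <= 3 + `|g| by have := normr_ge0 g; lra.
    have /andP[lM0 lMl] := lnM.
    apply: le_trans (_ : 1 * l * ((3 + `|g|) * (1 + l)) <= _).
      have l0 : 0 <= l by lra.
      apply: ler_pM; rewrite ?mulr_ge0 ?normr_ge0 ?ler_wpM2r //.
      by apply: le_trans hS _; rewrite ler_wpM2l // lerD2l.
    have : l * (1 + l) <= (1 + l) ^+ 2 by nra.
    nra.
  rewrite -big_distrr /=.
  have sN : Num.sqrt N%:R ^+ 2 = N%:R :> R by rewrite sqr_sqrtr ?ler0n.
  rewrite -{2}sN; have := sum_invsqrt_le N; have := sqrtr_ge0 (N%:R : R).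
  set S := \sum_(_ <= _ < _) _; set s := Num.sqrt N%:R => s0 Ss.
  have : 0 <= (3 + `|g|) * s by rewrite mulr_ge0 // addr_ge0.
  nra.
rewrite sum_divn_dvdn in main.
have mainE : \sum_(1 <= k < N.+1) f k *
     \sum_(1 <= d < N.+1 | (d %| k)%N) mobius R d * (ln N%:R - ln d%:R) =
   (psi N - N%:R + (g + 1)) * ln N%:R +
   (\sum_(1 <= k < N.+1) L k * psi (N %/ k) - N%:R * mertens R N + (g + 1) * psi N).
  rewrite (eq_big_seq (fun k => f k * (if k == 1%N then ln N%:R else 0) + f k * L k)); last first.
    by move=> k; rewrite mem_index_iota ltnS => kN; rewrite sum_mobius_lnN // addrC mulrDr addrC.
  rewrite big_split /= (bigD1_seq 1%N) ?iota_uniq ?mem_index_iota //= big1 ?addr0; last first.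
    by move=> k /negPf ->; rewrite mulr0.
  rewrite /f divn1 divr1; congr (_ + _).
  rewrite /mertens /psi !big_distrr /= -sumrB -big_split /=.
  by apply: eq_bigr => k _; ring.
rewrite mainE in main.
have pN := @psi_le R N; have p0 := @psi_ge0 R N.
have mlo := @mertens_ge R N N0; have mhi := @mertens_le R N N0.
have lnN : ln N%:R <= N%:R :> R by have := @ln_le_sub1 R N%:R NR; lra.
set S := \sum_(_ <= _ < _) _ in main *.
(* Both N ln N and N times the Mertens sum contribute N ln N up to O(N), hence the main term 2 N ln
   N. *)
rewrite (_ : _ - _ = ((psi N - N%:R + (g + 1)) * ln N%:R +
   (S - N%:R * mertens R N + (g + 1) * psi N)) + N%:R * (mertens R N - ln N%:R)
   - (g + 1) * (ln N%:R + psi N)); last by ring.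
apply: le_trans (ler_normB _ _) _; apply: le_trans (lerD (ler_normD _ _) (lexx _)) _.
have h1 : `|N%:R * (mertens R N - ln N%:R)| <= 4 * N%:R.
  rewrite normrM gtr0_norm // mulrC ler_pM2r // ler_norml; lra.
have h2 : `|(g + 1) * (ln N%:R + psi N)| <= 3 * `|g + 1| * N%:R.
  rewrite normrM [`|ln _ + _|]ger0_norm; last by lra.
  by have := normr_ge0 (g + 1); nra.
lra.
Qed.

End Selberg.

(** * Selberg's formula at real arguments and its use in short intervals *)

Section ShortIntervals.
Variable R : realType.
Implicit Types (x y z : R) (k n : nat).
Local Notation L := (Lambda R).
Local Notation psi := (psi R).
Local Notation truncn := Num.truncn.

Definition Psi x := psi (truncn x).

Lemma truncn_div x k : 0 <= x -> truncn (x / k%:R) = (truncn x %/ k)%N.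
Proof.
move=> x0; have [->|k0] := posnP k; first by rewrite divn0 invr0 mulr0 truncn0.
have kR : 0 < k%:R :> R by rewrite ltr0n.
apply: truncn_def; have /andP[lo hi] := truncn_itv x0.
rewrite ler_pdivlMr // ltr_pdivrMr // -!natrM; apply/andP; split.
  by apply: le_trans lo; rewrite ler_nat leq_divM.
by apply: lt_le_trans hi _; rewrite ler_nat ltn_ceil.
Qed.

Lemma Psi_le x y : x <= y -> Psi x <= Psi y.
Proof. by move=> xy; apply/le_psi/le_truncn. Qed.

Lemma Psi_ge0 x : 0 <= Psi x. Proof. exact: psi_ge0. Qed.

Lemma Psi_lin x : 0 <= x -> Psi x <= 7 / 4 * x.
Proof.
move=> x0; apply: le_trans (psi_le _ _) _.
by rewrite ler_pM2l ?truncn_le //; lra.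
Qed.

Lemma sum_gt_truncn (F : nat -> R) (P : pred nat) x y : 0 <= x -> x <= y ->
  \sum_(1 <= k < (truncn y).+1 | (x < k%:R) && P k) F k =
  \sum_(1 <= k < (truncn y).+1 | P k) F k - \sum_(1 <= k < (truncn x).+1 | P k) F k.
Proof.
move=> x0 xy; have xy' : (truncn x <= truncn y)%N by apply: le_truncn.
rewrite (big_cat_nat _ (n := (truncn x).+1) (p := (truncn y).+1)) //=.
rewrite big_seq_cond big_pred0 ?add0r; last first.
  move=> k; rewrite mem_index_iota ltnS truncn_ge_nat // ltNge.
  by case: (k%:R <= x); rewrite ?andbF.
rewrite [X in _ = X - _](big_cat_nat _ (n := (truncn x).+1) (p := (truncn y).+1)) //=.
rewrite addrAC subrr add0r big_seq_cond [RHS]big_seq_cond; apply: eq_bigl => k.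
rewrite mem_index_iota; case: ltnP => //= xk; congr (_ && _).
by rewrite -truncn_lt_nat // xk.
Qed.

Lemma ln_truncn x : 1 <= x -> ln x - 1 <= ln (truncn x)%:R /\ ln (truncn x)%:R <= ln x.
Proof.
move=> x1; have x0 : 0 <= x by lra.
have t1 : 1 <= (truncn x)%:R :> R by rewrite ler1n truncn_gt0.
have /andP[lo hi] := truncn_itv x0; rewrite -natr1 in hi.
split; last by rewrite ler_ln ?posrE; lra.
have := @ln_div_le R x (truncn x)%:R; rewrite ler_pdivlMr; last lra.
by move=> /(_ ltac:(lra) ltac:(lra)); nra.
Qed.

Lemma mertens_truncn x : 1 <= x ->
  ln x - 2 <= mertens R (truncn x) <= ln x + 4.
Proof.
move=> x1; have t0 : (0 < truncn x)%N by rewrite truncn_gt0.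
have [h1 h2] := ln_truncn x x1.
have := @mertens_ge R _ t0; have := @mertens_le R _ t0; lra.
Qed.

(** The terms with k > x vanish, so [K] is free; this lets the formulas at x and y be subtracted
    over one range. *)
Lemma selberg_real : exists2 C : R, 0 <= C & forall x K, 1 <= x -> (truncn x <= K)%N ->
  `|Psi x * ln x + \sum_(1 <= k < K.+1) L k * Psi (x / k%:R) - 2 * x * ln x|
    <= C * x.
Proof.
have [C [C0 CP]] := selberg R; exists (C + 6); first by lra.
move=> x K x1 xK; have x0 : 0 <= x by lra.
have t0 : (0 < truncn x)%N by rewrite truncn_gt0.
have -> : \sum_(1 <= k < K.+1) L k * Psi (x / k%:R) =
    \sum_(1 <= k < (truncn x).+1) L k * psi (truncn x %/ k).
  rewrite (big_cat_nat _ (n := (truncn x).+1) (p := K.+1)) //=.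
  rewrite [X in _ + X]big1_seq ?addr0; last first.
    move=> k; rewrite mem_index_iota => /andP[_ /andP[xk _]].
    by rewrite /Psi truncn_div // divn_small // psi0 mulr0.
  by apply: eq_bigr => k _; rewrite /Psi truncn_div.
have := CP _ t0; set S := \sum_(_ <= _ < _) _.
have [l1 l2] := ln_truncn x x1; have P0 := Psi_ge0 x; have P1 := Psi_lin x x0.
have /andP[lo hi] := truncn_itv x0; rewrite -natr1 in hi.
have lx : ln x <= x by have := @ln_le_sub1 R x; lra.
have lx0 : 0 <= ln x by rewrite ln_ge0.
have t1 : 1 <= (truncn x)%:R :> R by rewrite ler1n.
have lt : (truncn x)%:R * (ln x - ln (truncn x)%:R) <= 1 :> R.
  have := @ln_div_le R x (truncn x)%:R; rewrite ler_pdivlMr; last lra.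
  by move=> /(_ ltac:(lra) ltac:(lra)); lra.
have d1 : 0 <= Psi x * (ln x - ln (truncn x)%:R) <= 7 / 4 * x.
  by apply/andP; split; nra.
have d2 : 0 <= (x - (truncn x)%:R) * ln x <= x by apply/andP; split; nra.
have d3 : 0 <= (truncn x)%:R * (ln x - ln (truncn x)%:R).
  by rewrite mulr_ge0 ?ler0n // subr_ge0.
have d4 : C * (truncn x)%:R <= C * x by rewrite ler_wpM2l.
move: d1 d2; rewrite !ler_norml -/(Psi x); lra.
Qed.

Lemma short_interval_le (eta : R) : 0 < eta -> exists2 Y, 1 <= Y & forall x y,
  Y <= x -> x <= y -> y <= 2 * x -> Psi y - Psi x <= 2 * (y - x) + eta * x.
Proof.
move=> eta0; have [C C0 CP] := selberg_real.
have e1 : 1 <= expR ((4 + 3 * C) / eta).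
  by apply: le_trans (expR_ge1Dx _); rewrite lerDl divr_ge0; lra.
exists (expR ((4 + 3 * C) / eta)) => // x y Yx xy y2x.
have x1 : 1 <= x by apply: le_trans Yx.
have lnx : (4 + 3 * C) / eta <= ln x.
  by rewrite -[X in X <= _]expRK ler_ln ?posrE ?expR_gt0 //; lra.
have y1 : 1 <= y by lra.
have := CP x (truncn y) x1 (le_truncn xy); have := CP y (truncn y) y1 (leqnn _).
set Tx := \sum_(_ <= _ < _) L _ * Psi (x / _); set Ty := \sum_(_ <= _ < _) _.
have TxTy : Tx <= Ty.
  apply: ler_sum => k _; rewrite ler_wpM2l ?Lambda_ge0 // Psi_le //.
  by rewrite ler_wpM2r // invr_ge0 ler0n.
have lnxy : 0 <= ln y - ln x <= 1.
  have := @ln_div_le R y x; rewrite ler_pdivlMr; last lra.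
  have : ln x <= ln y by rewrite ler_ln ?posrE; lra.
  by move=> ? /(_ ltac:(lra) ltac:(lra)) ?; apply/andP; split; nra.
have Py0 := Psi_ge0 y; have Pxy := Psi_le x y xy.
have lx0 : 0 <= ln x by rewrite ln_ge0.
rewrite ler_pdivrMr // in lnx; rewrite !ler_norml => /andP[_ hy] /andP[hx _].
have [->|xy'] := eqVneq x y; first by nra.
have lx1 : 0 < ln x.
  rewrite ltNge; apply/negP => lx; suff : 0 < ln x by lra.
  by apply: lt_le_trans (_ : 4 / eta <= _); rewrite ?divr_gt0 ?ler_pdivrMr; lra.
rewrite -(ler_pM2r lx1).
have e0 : Psi y * (ln y - ln x) >= 0 by apply: mulr_ge0; lra.
have e2 : y * (ln y - ln x) <= 2 * x by nra.
have e3 : C * y <= C * (2 * x) by rewrite ler_wpM2l.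
have e4 : (4 + 3 * C) * x <= ln x * eta * x by rewrite ler_wpM2r //; lra.
lra.
Qed.

(* By [short_interval_le] the mass of (x/k, (1+c)x/k] is at most about 2cx/k;
   k is sparse when it misses this maximum by a proportion delta/2. *)
Definition sparse c delta x k :=
  Psi ((1 + c) * x / k%:R) - Psi (x / k%:R) < (2 - delta) * c * x / k%:R.

(** With no mass in (x, y], y = (1+c) x, Selberg's formula forces the sum of L(k) (Psi(y/k) -
    Psi(x/k)) to be 2 c x ln x - O(x). Termwise upper bounds nearly give this total, so sparse k,
    each losing delta c x/k, have little weight. *)
Lemma sparse_mass_le (c delta tau : R) : 0 < c <= 1 -> 0 < delta <= 1 -> 0 < tau ->
  exists2 X, 1 <= X & forall x, X <= x -> Psi ((1 + c) * x) = Psi x ->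
  \sum_(1 <= k < (truncn x).+1 | sparse c delta x k) L k / k%:R <= tau * ln x.
Proof.
move=> /andP[c0 c1] /andP[d0 d1] tau0.
have eta0 : 0 < delta * c * tau / 2 by rewrite divr_gt0 ?mulr_gt0.
set eta := delta * c * tau / 2 in eta0 *.
have [Y Y1 YP] := short_interval_le _ eta0; have [C C0 CP] := selberg_real.
(* The O(x) errors: Mertens at y, Selberg at x and y, and the k > x/Y, where only Chebyshev's bound
   is available. [eta] and C2 / ln x each use half of tau. *)
pose C2 := 5 * (2 * c + eta) + 3 * C + 2 + 8 * (ln Y + 7).
exists (expR (C2 / eta) + Y); first by have := expR_gt0 (C2 / eta); lra.
move=> x Xx gap; have Yx : Y <= x by have := expR_gt0 (C2 / eta); lra.
have x1 : 1 <= x by lra.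
have lnx : C2 / eta <= ln x.
  by rewrite -[X in X <= _]expRK ler_ln ?posrE ?expR_gt0 //; lra.
rewrite ler_pdivrMr // in lnx.
have lx0 : 0 <= ln x by rewrite ln_ge0.
have lY0 : 0 <= ln Y by rewrite ln_ge0.
set y := (1 + c) * x in gap *; have xy : x <= y by rewrite /y; nra.
have y2x : y <= 2 * x by rewrite /y; nra.
have y1 : 1 <= y by lra.
set K := truncn y.
pose D k := Psi (y / k%:R) - Psi (x / k%:R).
have lo : 2 * c * x * ln x - (3 * C + 2) * x <= \sum_(1 <= k < K.+1) L k * D k.
  have := CP x K x1 (le_truncn xy); have := CP y K y1 (leqnn _).
  rewrite !ler_norml => /andP[hy _] /andP[_ hx].
  rewrite /D; under eq_bigr do rewrite mulrBr.
  rewrite sumrB; move: hx hy; rewrite -/K.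
  set Tx := \sum_(_ <= _ < _) L _ * Psi (x / _); set Ty := \sum_(_ <= _ < _) _.
  have lnxy : 0 <= ln y - ln x <= 1.
    have := @ln_div_le R y x; rewrite ler_pdivlMr; last lra.
    have : ln x <= ln y by rewrite ler_ln ?posrE; lra.
    by move=> ? /(_ ltac:(lra) ltac:(lra)) ?; apply/andP; split; nra.
  have Px := @Psi_lin x ltac:(lra); have Px0 := Psi_ge0 x.
  rewrite gap => hx hy.
  have e1 : Psi x * (ln y - ln x) <= 7 / 4 * x by nra.
  have e2 : 0 <= y * (ln y - ln x) by nra.
  have e3 : y * ln x = x * ln x + c * x * ln x by rewrite /y; ring.
  have e4 : C * y <= C * (2 * x) by rewrite ler_wpM2l.
  lra.
have xk0 k : 0 <= x / k%:R by rewrite divr_ge0 ?ler0n //; lra.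
have yk k : y / k%:R = x / k%:R + c * (x / k%:R) by rewrite /y; ring.
have pointwise k : D k <= (2 * c + eta) * (x / k%:R)
    - (if sparse c delta x k && (k < (truncn x).+1)%N then delta * c * (x / k%:R) else 0)
    + (if x / Y < k%:R then 8 * (x / k%:R) else 0).
  have [k0|k0] := posnP k.
    rewrite /D k0 !invr0 !mulr0 subrr !if_same; lra.
  have kR : 0 < k%:R :> R by rewrite ltr0n.
  have dc : 0 <= delta * c <= 1 by apply/andP; split; nra.
  have /andP[dc0 dc1] := dc; have v0 := xk0 k; have yv := yk k.
  have cv : 0 <= c * (x / k%:R) <= x / k%:R by apply/andP; split; nra.
  rewrite ltr_pdivrMr; last lra.
  case: ltP => [_|]; last first.
    rewrite mulrC -ler_pdivlMr // => kY; rewrite addr0.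
    have := YP _ (y / k%:R) kY; rewrite yv => /(_ ltac:(lra) ltac:(lra)); rewrite -yv.
    case: ifP => [/andP[bk _]|_]; last by rewrite /D; lra.
    by move: bk; rewrite /sparse -/y /D -!mulrA; nra.
  have : D k <= 7 / 2 * (x / k%:R).
    have := @Psi_lin (y / k%:R) ltac:(lra); have := Psi_ge0 (x / k%:R).
    by rewrite /D; lra.
  by case: ifP => _; nra.
have hi : \sum_(1 <= k < K.+1) L k * D k <= (2 * c + eta) * x * mertens R K
    - delta * c * x * \sum_(1 <= k < (truncn x).+1 | sparse c delta x k) L k / k%:R
    + 8 * x * \sum_(1 <= k < K.+1 | (x / Y < k%:R) && true) L k / k%:R.
  apply: le_trans (ler_sum _ (fun k _ => ler_wpM2l (Lambda_ge0 R k) (pointwise k))) _.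
  rewrite (big_nat_widen 1 (truncn x).+1 K.+1); last by rewrite ltnS le_truncn.
  rewrite [X in _ <= _ - _ * X + _]big_mkcond [X in _ <= _ + _ * X]big_mkcond.
  rewrite /mertens !big_distrr /=.
  rewrite -sumrB -big_split /=; apply: ler_sum => k _; rewrite andbT.
  by case: ifP => _; case: ifP => _; rewrite le_eqVlt; apply/orP; left; apply/eqP; ring.
rewrite sum_gt_truncn in hi; last 2 first.
- by rewrite divr_ge0; lra.
- by rewrite ler_pdivrMr; nra.
have xY1 : 1 <= x / Y by rewrite ler_pdivlMr; lra.
have /andP[_ My] := mertens_truncn y y1; have /andP[Mxy _] := mertens_truncn _ xY1.
rewrite ln_div ?posrE in Mxy; try lra.
have lny : ln y <= ln x + 1.
  have := @ln_div_le R y x; rewrite ler_pdivlMr; last lra.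
  by move=> /(_ ltac:(lra) ltac:(lra)) ?; nra.
set B := \sum_(1 <= k < (truncn x).+1 | sparse c delta x k) _ in hi *.
have dcx : 0 < delta * c * x by rewrite !mulr_gt0 //; lra.
rewrite -(ler_pM2l dcx).
have g1 : (2 * c + eta) * x * mertens R K <= (2 * c + eta) * x * (ln x + 5).
  by rewrite ler_wpM2l ?mulr_ge0; lra.
have g2 : 8 * x * (mertens R K - mertens R (truncn (x / Y))) <= 8 * x * (ln Y + 7).
  by rewrite ler_wpM2l ?mulr_ge0; lra.
have g3 : C2 * x <= ln x * eta * x by rewrite ler_wpM2r //; lra.
have g4 : delta * c * x * (tau * ln x) = 2 * (eta * x * ln x) by rewrite /eta; field.
rewrite g4; move: hi g1 g2 g3; rewrite /C2 /mertens; lra.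
Qed.

End ShortIntervals.

(** * Chains of dense intervals and the prime power gap theorem *)

Section PrimeGaps.
Variable R : realType.
Implicit Types (x y z c : R) (k n j T : nat).
Local Notation L := (Lambda R).
Local Notation truncn := Num.truncn.

Lemma le_sum_truncn (F : nat -> R) (P Q : pred nat) x y :
  (forall k, 0 <= F k) -> 0 <= x -> 0 <= y ->
  (forall k, (0 < k)%N -> k%:R <= y -> P k -> (k%:R <= x) && Q k) ->
  \sum_(1 <= k < (truncn y).+1 | P k) F k <= \sum_(1 <= k < (truncn x).+1 | Q k) F k.
Proof.
move=> F0 x0 y0 PQ; pose K := maxn (truncn x) (truncn y).
rewrite (big_nat_widen 1 (truncn y).+1 K.+1) ?ltnS ?leq_maxr //.
rewrite (big_nat_widen 1 (truncn x).+1 K.+1) ?ltnS ?leq_maxl //.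
rewrite big_mkcond [leRHS]big_mkcond /= big_seq [leRHS]big_seq.
apply: ler_sum => k; rewrite mem_index_iota => /andP[k0 _].
rewrite !ltnS !truncn_ge_nat //.
case: ifP => [/andP[Pk ky]|_]; last by case: ifP.
by have /andP[-> ->] := PQ k k0 ky Pk.
Qed.

Lemma exists_unmarked (F : nat -> R) (P : pred nat) z y : 0 <= y ->
  \sum_(1 <= k < (truncn y).+1 | (z < k%:R) && P k) F k <
    \sum_(1 <= k < (truncn y).+1 | (z < k%:R) && true) F k ->
  exists k, z < (k%:R : R) <= y /\ ~~ P k.
Proof.
move=> y0 hm; apply: contrapT => nex; move: hm.
rewrite big_mkcond [ltRHS]big_mkcond /= (@eq_big_seq _ _ _ _ _ _
  (fun k => if (z < k%:R) && true then F k else 0)) ?ltxx // => k.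
rewrite mem_index_iota ltnS truncn_ge_nat // => /andP[k0 ky].
case: ltP => //= zk; suff -> : P k by [].
by apply/negPn/negP => nPk; apply: nex; exists k; rewrite zk ky.
Qed.

(** As 1/k >= 1/y for k <= y, a mass rho y of [Psi] has weight at least rho under L(k)/k. *)
Lemma exists_unmarked_of_Psi (P : pred nat) (rho : R) z y : 0 <= z -> z <= y -> 0 < y ->
  rho * y <= Psi R y - Psi R z ->
  \sum_(1 <= k < (truncn y).+1 | (z < k%:R) && P k) L k / k%:R < rho ->
  exists k, z < (k%:R : R) <= y /\ ~~ P k.
Proof.
move=> z0 zy y0 hP hm; apply: (exists_unmarked (fun k => L k / k%:R)); first exact: ltW.
have h : \sum_(1 <= k < (truncn y).+1 | (z < k%:R) && true) L k / y <=
    \sum_(1 <= k < (truncn y).+1 | (z < k%:R) && true) L k / k%:R.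
  rewrite big_seq_cond [leRHS]big_seq_cond; apply: ler_sum => k.
  rewrite mem_index_iota ltnS truncn_ge_nat; last exact: ltW.
  move=> /andP[/andP[k0 ky] _].
  by rewrite ler_wpM2l ?Lambda_ge0 // lef_pV2 ?posrE ?ltr0n.
apply: lt_le_trans h; rewrite -big_distrl /= [X in _ < X / _]sum_gt_truncn //.
rewrite ltr_pdivlMr //; apply: (@lt_le_trans _ _ (rho * y)); last exact: hP.
by rewrite ltr_pM2r.
Qed.

(** Two reflections k -> x/k lead from p to q: a just above x/p, then w = x/a just below p, then q
    near the end of (w, (1+c) w]. The factor 2 in the windows makes room for the values x/k just
    below p. *)
Lemma chain_step (c s Y W W' x : R) (p : nat) : 0 < c <= 1 -> s = c / 40 -> 1 <= Y ->
  (forall u v, Y <= u -> u <= v -> v <= 2 * u ->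
     Psi R v - Psi R u <= 2 * (v - u) + s / 8 * u) ->
  2 * Y <= W -> W' * Y <= x ->
  \sum_(1 <= k < (truncn x).+1 | (W <= 2 * (k%:R : R) < W') && sparse R c (s / 2) x k)
    L k / k%:R < s / 2 ->
  \sum_(1 <= k < (truncn x).+1 | (W <= 2 * (x / k%:R) < W') && sparse R c (s / 2) x k)
    L k / k%:R < s / 2 ->
  W <= p%:R -> 4 * p%:R < W' -> ~~ sparse R c (s / 2) x p ->
  exists q, [/\ ~~ sparse R c (s / 2) x q, (1 + c / 2) * p%:R <= (q%:R : R) <= 2 * p%:R
    & 39 / 20 * (q%:R - p%:R) <= Psi R q%:R - Psi R p%:R].
Proof.
move=> /andP[c0 c1] sE Y1 short YW W'x massk massm Wp pW' pgood.
have s0 : 0 < s by lra.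
have p2 : 2 <= p%:R :> R by lra.
have p0 : 0 < p%:R :> R by lra.
have x0 : 0 < x by nra.
have px : 4 * p%:R <= x by nra.
set b := sparse R c (s / 2) x in massk massm pgood *.
have LV k : 0 <= L k / k%:R by rewrite divr_ge0 ?Lambda_ge0 ?ler0n.
set z := x / p%:R.
have zp : z * p%:R = x by rewrite /z divfK ?gt_eqF.
have Yz : Y <= z by rewrite /z ler_pdivlMr //; nra.
have small u : 0 < u -> [/\ 0 < s * u, s * c * u <= s * u & s * s * u <= s * u / 40].
  move=> u0; have su : 0 < s * u by rewrite mulr_gt0.
  by split => //; rewrite mulrAC; nra.
have z0 : 0 < z by lra.
have [sz1 sz2 sz3] := small z z0.
have pgood' : (2 - s / 2) * c * z <= Psi R ((1 + c) * z) - Psi R z.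
  by move: pgood; rewrite /b /sparse -leNgt -!mulrA.
(* Almost all the mass of (z, (1+c)z] is present, so some lies just above z. *)
have [a [/andP[za ay] agood]] : exists k, z < k%:R <= (1 + s) * z /\ ~~ b k.
  apply: (exists_unmarked_of_Psi b (s / 2)); [lra|nra|nra| |].
    have := short ((1 + s) * z) ((1 + c) * z) ltac:(nra) ltac:(nra) ltac:(nra).
    lra.
  apply: le_lt_trans massm; apply: le_sum_truncn => //; [lra|nra|].
  move=> k k0 ky /andP[zk bk]; rewrite bk andbT.
  have kR : 0 < k%:R :> R by rewrite ltr0n.
  rewrite andbC; apply/andP; split; last by nra.
  have e1 : x / k%:R < p%:R by rewrite ltr_pdivrMr // mulrC; nra.
  have e2 : p%:R / 2 <= x / k%:R by rewrite ler_pdivlMr //; nra.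
  by apply/andP; split; lra.
have a0 : 0 < a%:R :> R by lra.
set w := x / a%:R.
have wa : w * a%:R = x by rewrite /w divfK ?gt_eqF.
have wp : w < p%:R by rewrite /w ltr_pdivrMr // mulrC; nra.
have pw : p%:R <= (1 + s) * w by rewrite /w mulrA ler_pdivlMr //; nra.
have w0 : 0 < w by rewrite divr_gt0.
have [sw1 sw2 sw3] := small w w0.
have Yw : Y <= w by nra.
have agood' : (2 - s / 2) * c * w <= Psi R ((1 + c) * w) - Psi R w.
  by move: agood; rewrite /b /sparse -leNgt -!mulrA.
(* Now w = x/a is just below p, and (w, (1+c)w] has almost maximal mass. *)
have [q [/andP[qlo qhi] qgood]] :
    exists k, (1 + c - s) * w < k%:R <= (1 + c) * w /\ ~~ b k.
  apply: (exists_unmarked_of_Psi b (s / 2)); [nra|nra|nra| |].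
    have := short w ((1 + c - s) * w) ltac:(nra) ltac:(nra) ltac:(nra).
    lra.
  apply: le_lt_trans massk; apply: le_sum_truncn => //; [lra|nra|].
  move=> k k0 ky /andP[zk bk]; rewrite bk andbT.
  rewrite andbC; apply/andP; split; last by nra.
  by apply/andP; split; nra.
exists q; split => //; first by apply/andP; split; nra.
(* Removing the maximal masses of (w, p] and (q, (1+c) w] from that of (w, (1+c) w] leaves 2 (q -
   p), up to an error of at most s w <= (q - p)/20. *)
have := short q%:R ((1 + c) * w) ltac:(nra) ltac:(nra) ltac:(nra).
have := short w p%:R ltac:(nra) ltac:(nra) ltac:(nra).
nra.
Qed.

Lemma chain (c s Y W W' x : R) i : 0 < c <= 1 -> s = c / 40 -> 1 <= Y ->
  (forall u v, Y <= u -> u <= v -> v <= 2 * u ->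
     Psi R v - Psi R u <= 2 * (v - u) + s / 8 * u) ->
  2 * Y <= W -> W' * Y <= x ->
  \sum_(1 <= k < (truncn x).+1 | (W <= 2 * (k%:R : R) < W') && sparse R c (s / 2) x k)
    L k / k%:R < s / 2 ->
  \sum_(1 <= k < (truncn x).+1 | (W <= 2 * (x / k%:R) < W') && sparse R c (s / 2) x k)
    L k / k%:R < s / 2 ->
  forall p, W <= p%:R -> 4 * (2 ^+ i * p%:R) < W' -> ~~ sparse R c (s / 2) x p ->
  exists q, [/\ ~~ sparse R c (s / 2) x q, (1 + c / 2) ^+ i * p%:R <= (q%:R : R) <= 2 ^+ i * p%:R
    & 39 / 20 * (q%:R - p%:R) <= Psi R q%:R - Psi R p%:R].
Proof.
move=> cP sE Y1 short YW W'x massk massm p Wp; have /andP[c0 c1] := cP.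
have p0 : 0 < p%:R :> R by lra.
elim: i => [|i IH] pW' pgood.
  by exists p; split; rewrite ?expr0 ?mul1r ?lexx // !subrr mulr0.
have e2 : 0 < (2 : R) ^+ i * p%:R by rewrite mulr_gt0 // exprn_gt0.
have [|q [qgood /andP[qlo qhi] qPsi]] := IH _ pgood; first by rewrite exprS in pW'; lra.
have pq : p%:R <= (1 + c / 2) ^+ i * p%:R :> R.
  by rewrite ler_peMl ?(ltW p0) // exprn_ege1 //; lra.
have [|| q' [q'good /andP[q'lo q'hi] q'Psi]] :=
  chain_step _ _ _ _ _ _ q cP sE Y1 short YW W'x massk massm _ _ qgood.
- lra.
- by rewrite exprS in pW'; lra.
exists q'; split => //; last by lra.
by rewrite !exprS -!mulrA; apply/andP; split; [nra|lra].
Qed.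

Lemma sum_window (Q u : R) j0 T : 1 < Q -> (j0 <= T)%N ->
  \sum_(j0 <= j < T) (Q ^+ j <= u < Q ^+ j.+1)%R%:R <= 1 :> R.
Proof.
move=> Q1 j0T; suff -> : \sum_(j0 <= j < T) (Q ^+ j <= u < Q ^+ j.+1)%R%:R =
    (Q ^+ j0 <= u < Q ^+ T)%R%:R :> R by case: (_ && _); rewrite ?ler01.
elim: T j0T => [|T IH]; rewrite leq_eqVlt => /predU1P[->|]; rewrite ?ltn0 //.
- by rewrite big_geq //; case: leP => // /le_gtF ->.
- by rewrite big_geq //; case: leP => // /le_gtF ->.
rewrite ltnS => j0T; rewrite big_nat_recr //= IH //.
have h1 : Q ^+ j0 <= Q ^+ T by rewrite ler_weXn2l // ltW.
have h2 : Q ^+ T < Q ^+ T.+1 by rewrite ltr_eXn2l.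
case: (leP (Q ^+ j0) u) => a1; case: (ltP u (Q ^+ T)) => a2;
  case: (leP (Q ^+ T) u) => a3; case: (ltP u (Q ^+ T.+1)) => a4 //=;
  rewrite ?addr0 ?add0r //; lra.
Qed.

(** The windows are disjoint, so the masses for [u] and [v] over all of them add up to at most twice
    the mass of [P]; some window is below average. *)
Lemma exists_window (Q beta : R) j0 T K (F u v : nat -> R) (P : pred nat) :
  1 < Q -> (j0 <= T)%N -> (forall k, 0 <= F k) ->
  2 * (\sum_(1 <= k < K | P k) F k) < beta * (T - j0)%N%:R ->
  exists j, [/\ (j0 <= j < T)%N,
    \sum_(1 <= k < K | (Q ^+ j <= u k < Q ^+ j.+1) && P k) F k < beta &
    \sum_(1 <= k < K | (Q ^+ j <= v k < Q ^+ j.+1) && P k) F k < beta].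
Proof.
move=> Q1 j0T F0 small; apply: contrapT => nex.
pose m (w : nat -> R) j := \sum_(1 <= k < K | (Q ^+ j <= w k < Q ^+ j.+1) && P k) F k.
have mle w : \sum_(j0 <= j < T) m w j <= \sum_(1 <= k < K | P k) F k.
  under eq_bigr => j _ do rewrite /m big_mkcondl.
  rewrite exchange_big /=; apply: ler_sum => k _.
  have E j : (if Q ^+ j <= w k < Q ^+ j.+1 then F k else 0) =
      F k * (Q ^+ j <= w k < Q ^+ j.+1)%R%:R.
    by case: (_ && _); rewrite ?mulr1 ?mulr0.
  by under eq_bigr do rewrite E; rewrite -big_distrr ler_piMr // sum_window.
have m0 w j : 0 <= m w j by apply: sumr_ge0.
have : \sum_(j0 <= j < T) beta <= \sum_(j0 <= j < T) (m u j + m v j).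
  rewrite big_seq [leRHS]big_seq; apply: ler_sum => j; rewrite mem_index_iota => jT.
  rewrite leNgt; apply/negP => hlt; apply: nex; exists j; split => //.
    by apply: le_lt_trans hlt; rewrite lerDl.
  by apply: le_lt_trans hlt; rewrite lerDr.
rewrite big_const_nat iter_addr_0 -mulr_natr big_split /=.
have := mle u; have := mle v; lra.
Qed.

Lemma exp2_ge n : n%:R <= 2 ^+ n :> R.
Proof. by rewrite -natrX ler_nat ltnW // ltn_expl. Qed.

(** The tangent to x^(n+1) at b; b = 1 is Bernoulli's inequality. In the induction the difference is
    (n+1) b^n (a - b)^2. *)
Lemma expr_tangent_le (a b : R) n : 0 <= a -> 0 <= b ->
  b ^+ n.+1 + n.+1%:R * b ^+ n * (a - b) <= a ^+ n.+1.
Proof.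
move=> a0 b0; elim: n => [|n IH]; first by rewrite !expr1 expr0; lra.
rewrite [leRHS]exprS; apply: le_trans (ler_wpM2l a0 IH).
rewrite -subr_ge0 (_ : _ - _ = n.+1%:R * b ^+ n * (a - b) ^+ 2).
  by rewrite mulr_ge0 ?sqr_ge0 // mulr_ge0 ?ler0n ?exprn_ge0.
by rewrite !exprS -[n.+2%:R]natr1; ring.
Qed.

(** By Mertens (W, Q1 W] has weight at least ln Q1 - 6 >= 4, more than the sparse k carry, so it
    contains a non-sparse p0. J steps, each at most doubling, stay in the window and reach q >= 100
    p0 with Psi q >= 39/20 (q - p0) > 7/4 q. *)
Lemma window_absurd (c s Y Q1 W x : R) J : 0 < c <= 1 -> s = c / 40 -> 1 <= Y ->
  (forall u v, Y <= u -> u <= v -> v <= 2 * u ->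
     Psi R v - Psi R u <= 2 * (v - u) + s / 8 * u) ->
  100 <= (1 + c / 2) ^+ J -> 1 <= Q1 -> 10 <= ln Q1 ->
  let W' := 8 * (2 ^+ J * (Q1 * W)) in
  2 * Y <= W -> W' * Y <= x ->
  \sum_(1 <= k < (truncn x).+1 | (W <= 2 * (k%:R : R) < W') && sparse R c (s / 2) x k)
    L k / k%:R < s / 2 ->
  \sum_(1 <= k < (truncn x).+1 | (W <= 2 * (x / k%:R) < W') && sparse R c (s / 2) x k)
    L k / k%:R < s / 2 ->
  False.
Proof.
move=> cP sE Y1 short J100 Q1_1 lnQ1 W' YW W'x massk massm.
have /andP[c0 c1] := cP.
have LV k : 0 <= L k / k%:R by rewrite divr_ge0 ?Lambda_ge0 ?ler0n.
have W2 : 2 <= W by lra.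
have WQ1 : W <= Q1 * W by rewrite ler_peMl //; lra.
have J1 : 1 <= (2 : R) ^+ J by rewrite exprn_ege1 //; lra.
have QW : Q1 * W <= 2 ^+ J * (Q1 * W) by rewrite ler_peMl //; lra.
have W'E : W' = 8 * (2 ^+ J * (Q1 * W)) by [].
have W'x' : W' <= x by apply: le_trans W'x; rewrite ler_peMr //; lra.
clearbody W'.
have [p0 [/andP[p0lo p0hi] p0good]] :
    exists k, W < (k%:R : R) <= Q1 * W /\ ~~ sparse R c (s / 2) x k.
  apply: (exists_unmarked (fun k => L k / k%:R)) => //; first lra.
  apply: (@lt_trans _ _ 1).
    apply: (@lt_trans _ _ (s / 2)); last by lra.
    apply: le_lt_trans massk; apply: le_sum_truncn => //; [lra|lra|].
    move=> k k0 kQ /andP[Wk bk]; rewrite bk andbT andbC.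
    by apply/andP; split; [apply/andP; split|]; lra.
  rewrite [ltRHS]sum_gt_truncn; [|lra|lra].
  have QW1 : 1 <= Q1 * W by lra.
  have W1 : 1 <= W by lra.
  have := mertens_truncn _ _ QW1; have := mertens_truncn _ _ W1.
  rewrite lnM ?posrE /mertens; [lra|lra|lra].
have p00 : 0 < p0%:R :> R by lra.
have Jp0 : 2 ^+ J * p0%:R <= 2 ^+ J * (Q1 * W) by rewrite ler_wpM2l //; lra.
have [||q [_ /andP[qlo qhi] qPsi]] :=
  chain c s Y W W' x J cP sE Y1 short YW W'x massk massm p0 _ _ p0good; [lra|lra|].
have q100 : 100 * p0%:R <= q%:R :> R.
  by apply: le_trans qlo; rewrite ler_wpM2r // ltW.
have := @Psi_lin R q%:R (ler0n _ _); have := Psi_ge0 R p0%:R; lra.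
Qed.

Lemma Psi_gap_lt c : 0 < c <= 1 ->
  exists X, forall x, X <= x -> Psi R x < Psi R ((1 + c) * x).
Proof.
move=> cP; have /andP[c0 c1] := cP.
pose s := c / 40; have s0 : 0 < s by rewrite /s; lra.
have s80 : 0 < s / 8 by lra.
have [Y Y1 short] := @short_interval_le R (s / 8) s80.
have [J J100] : exists J, 100 <= (1 + c / 2) ^+ J.
  exists (truncn (200 / c)).+1.
  have := truncnS_gt (200 / c); rewrite ltr_pdivrMr // => Jc.
  have := @expr_tangent_le (1 + c / 2) 1 (truncn (200 / c)) ltac:(lra) ler01.
  by rewrite !expr1n; lra.
have [Q1 Q1_1 lnQ1] : exists2 Q1 : R, 1 <= Q1 & 10 <= ln Q1.
  exists (2 ^+ 20); first by rewrite exprn_ege1 //; lra.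
  by have := ln2_ge R; rewrite lnXn //; lra.
have [Q QE] : exists Q : R, Q = 8 * (2 ^+ J * Q1) by eexists.
have J1 : 1 <= (2 : R) ^+ J by rewrite exprn_ege1 //; lra.
have Q8 : 8 <= Q by rewrite QE; nra.
have lnQ : 0 < ln Q by rewrite ln_gt0; lra.
have [j0 Qj0] : exists j0, 2 * Y <= Q ^+ j0.
  exists (truncn (2 * Y)).+1.
  apply: le_trans (_ : (truncn (2 * Y)).+1%:R <= _); first by apply/ltW/truncnS_gt.
  apply: le_trans (exp2_ge _) _; rewrite lerXn2r ?nnegrE; lra.
(* There will be more than ln x / (2 ln Q) windows, so twice the sparse mass, at most tau ln x,
   averages below s/2 per window. *)
have tau0 : 0 < s / 2 / (4 * ln Q) by rewrite !divr_gt0 ?mulr_gt0.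
have d0 : 0 < s / 2 <= 1 by apply/andP; rewrite /s; split; lra.
have [X X1 sparse_le] := @sparse_mass_le R c (s / 2) _ cP d0 tau0.
(* Makes ln x large enough for T - j0 > ln x / (2 ln Q), where Q^T <= x/Y. *)
pose C := 2 * (ln Y + (2 + j0%:R) * ln Q).
exists (X + expR C + Y) => x Xx.
have eC := expR_gt0 C.
have x0 : 0 < x by lra.
have x1 : 1 <= x by lra.
rewrite ltNge; apply/negP => le_gap.
have gap : Psi R ((1 + c) * x) = Psi R x.
  by apply/eqP; rewrite eq_le le_gap Psi_le //; nra.
have lnx : C <= ln x by rewrite -[C]expRK ler_ln ?posrE ?expR_gt0 //; lra.
have lnY : 0 <= ln Y by rewrite ln_ge0.
pose T := truncn ((ln x - ln Y) / ln Q).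
have Yx : ln Y <= ln x by rewrite ler_ln ?posrE; lra.
have T0 : 0 <= (ln x - ln Y) / ln Q by rewrite divr_ge0; lra.
have /andP[Tlo Thi] := truncn_itv T0; rewrite -/T -natr1 in Tlo Thi.
rewrite ler_pdivlMr // in Tlo; rewrite ltr_pdivrMr // in Thi.
have Tj0 : ln x / (2 * ln Q) < T%:R - j0%:R.
  rewrite ltr_pdivrMr; last by rewrite mulr_gt0.
  by move: lnx; rewrite /C; nra.
have j0T : (j0 <= T)%N.
  rewrite -(ler_nat R); have : 0 <= ln x / (2 * ln Q).
    by rewrite divr_ge0 ?mulr_ge0 ?ln_ge0 //; lra.
  lra.
have LV k : 0 <= L k / k%:R by rewrite divr_ge0 ?Lambda_ge0 ?ler0n.
(* The chain needs few sparse k both near p and near its mirror image x/p. *)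
have := @exists_window Q (s / 2) j0 T (truncn x).+1 (fun k => L k / k%:R)
  (fun k => 2 * k%:R) (fun k => 2 * (x / k%:R)) (sparse R c (s / 2) x) _ j0T LV.
case=> [||j [/andP[j0j jT] massk massm]]; first lra.
  apply: le_lt_trans (_ : s / 2 * (ln x / (2 * ln Q)) < _); last first.
    by rewrite natrB // ltr_pM2l; lra.
  have := sparse_le x ltac:(lra) gap; set B := \sum_(_ <= _ < _ | _) _ => hB.
  rewrite (_ : s / 2 * _ = 2 * (s / 2 / (4 * ln Q) * ln x)); last first.
    by field; rewrite gt_eqF.
  lra.
have Wlo : 2 * Y <= Q ^+ j.
  by apply: le_trans Qj0 _; rewrite ler_weXn2l //; lra.
have Whi : Q ^+ j.+1 * Y <= x.
  have QT : Q ^+ T * Y <= x.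
    have Q0 : 0 < Q by lra.
    have Y0 : 0 < Y by lra.
    rewrite -ler_ln ?posrE ?mulr_gt0 ?exprn_gt0 //.
    by rewrite lnM ?posrE ?exprn_gt0 // lnXn // -[ln Q *+ T]mulr_natl; lra.
  apply: le_trans QT; rewrite ler_wpM2r //; first lra.
  by rewrite ler_weXn2l //; lra.
have WE : Q ^+ j.+1 = 8 * (2 ^+ J * (Q1 * Q ^+ j)) by rewrite exprS {1}QE; ring.
rewrite WE in Whi massk massm.
exact: (window_absurd c s Y Q1 (Q ^+ j) x J cP erefl Y1 short J100 Q1_1 lnQ1 Wlo Whi massk massm).
Qed.

Theorem prime_power_between c : 0 < c <= 1 ->
  exists X, forall x, X <= x ->
  exists2 q, prime_power q & x < (q%:R : R) <= (1 + c) * x.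
Proof.
move=> cP; have [X XP] := Psi_gap_lt c cP; have /andP[c0 c1] := cP.
exists (Num.max X 1) => x; rewrite ge_max => /andP[/XP lt_Psi x1].
have [k [kx /Lambda_neq0 [p [i [p_pr i0 kE]]]]] :
    exists k, x < (k%:R : R) <= (1 + c) * x /\ ~~ (L k == 0).
  apply: (exists_unmarked L); first by nra.
  rewrite [ltRHS]sum_gt_truncn; [|lra|nra].
  by rewrite big1 ?subr_gt0 // => k /andP[_ /eqP].
by exists k => //; exists p, i.
Qed.

End PrimeGaps.

(** * Asymptotics *)

Local Open Scope classical_set_scope.
Local Open Scope ring_scope.

Lemma prime_power_gt1 q : prime_power q -> (1 < q)%N.
Proof. by move=> [p [k [p_pr k0 ->]]]; rewrite -(exp1n k) ltn_exp2r // prime_gt1. Qed.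

Lemma leq_sum_tangent (I : finType) (d f : I -> nat) x y s :
  (forall a, x + d a * y <= f a + s * y)%N ->
  (#|I| * x + (\sum_a d a) * y <= \sum_a f a + #|I| * (s * y))%N.
Proof.
move=> h; rewrite -!sum_nat_const big_distrl -!big_split /=.
by apply: leq_sum => a _.
Qed.

Lemma zarankiewicz_2_3_le q : (1 < q)%N ->
  (zarankiewicz (q * (q ^ 2 + 1)) (q ^ 2 + 1) 2 3 <= (q ^ 2 + q) * (q ^ 2 + 1))%N.
Proof.
move=> q1; set n := (q ^ 2 + 1)%N; apply/bigmax_leqP => E /sum_bin_neighbours.
rewrite card_ord -sum_card_neighbours => hE.
(* The design identity: with all degrees equal to q + 1 the triple count is exact, so the tangent
   there loses nothing. *)
have binE : ('C(n, 3) = q * n * 'C(q.+1, 3))%N.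
  apply/eqP; rewrite -(eqn_pmul2r (fact_gt0 3)) -mulnA !bin_ffact /n.
  rewrite !ffactnS !ffactn0 !muln1.
  have -> : n.-1 = (q ^ 2)%N by rewrite /n addn1.
  have -> : (q ^ 2).-1 = (q.-1 * q.+1)%N by rewrite -mulnn; nia.
  by rewrite -mulnn /=; apply/eqP; ring.
have pos : (0 < 'C(q.+1, 2))%N by rewrite bin_gt0 ltnS ltnW.
rewrite -(leq_pmul2r pos).
have := leq_sum_tangent _ _ _ _ _ _ (fun a => bin_tangent #|neighbours E a| q.+1 2).
rewrite card_ord binE in hE *; move: hE; set S := (\sum_a _)%N; set D := (\sum_a _)%N.
move: 'C(_, 3) 'C(_, 2) S D => c3 c2 S D; nia.
Qed.

Lemma zarankiewicz_2_3 q : prime_power q ->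
  zarankiewicz (q * (q ^ 2 + 1)) (q ^ 2 + 1) 2 3 = ((q ^ 2 + q) * (q ^ 2 + 1))%N.
Proof.
move=> qP; have q1 := prime_power_gt1 _ qP; apply/eqP; rewrite eqn_leq zarankiewicz_2_3_le //=.
have [p [k [p_pr k0 qE]]] := qP.
have [|K pK cardK] := @pPrimePowerField p (k * 2) p_pr; first by rewrite muln_gt0 k0.
apply: (@leq_zarankiewicz_inversive K) => //.
- by rewrite cardK qE expnM.
- move=> x y; apply: exprDn_pchar.
  by rewrite qE pnatX pnatE // pK.
- nia.
Qed.

Lemma leq_ffact_expn n k : (n ^_ k <= n ^ k)%N.
Proof.
elim: k n => [|k IH] n; first by rewrite ffactn0.
rewrite ffactnS expnS leq_mul2l; apply/orP; right.
by apply: leq_trans (IH _) _; case: k {IH} => // k; rewrite leq_exp2r // leq_pred.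
Qed.

Lemma leq_expn_ffact d k : ((d - k) ^ k <= d ^_ k)%N.
Proof.
elim: k d => [|k IH] d; first by rewrite ffactn0.
rewrite ffactnS expnS leq_mul ?leq_subr //.
by apply: leq_trans (IH _); rewrite -subn1 -subnDA add1n.
Qed.

(** Powers replace binomials so that the tangent at the real point sqrt n can be used; the shift by
    [k] is negligible against sqrt n. *)
Lemma sum_expn_neighbours (A B : finType) (E : {set A * B}) k :
  complete_bip_free 2 k E ->
  (\sum_a (#|neighbours E a| - k) ^ k <= #|B| ^ k)%N.
Proof.
move=> /sum_bin_neighbours; rewrite -(leq_pmul2r (fact_gt0 k)) bin_ffact big_distrl /= => h.
apply: leq_trans (leq_ffact_expn _ _); apply: leq_trans h; apply: leq_sum => a _.
by rewrite bin_ffact leq_expn_ffact.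
Qed.

(** Tangent to x^(r+1) at t = sqrt n, summed and divided by t^r. The second term measures how far m
    is from t^(r+1), the third is the cost of shifting degrees by r + 1. *)
Lemma zarankiewicz_2_le (R : realType) (m n r : nat) : (0 < n)%N ->
  (zarankiewicz m n 2 r.+1)%:R <=
  m%:R * Num.sqrt n%:R + Num.sqrt n%:R * `|Num.sqrt n%:R ^+ r.+1 - m%:R| + m%:R * r.+1%:R :> R.
Proof.
move=> n0; set t : R := Num.sqrt n%:R.
have t0 : 0 < t by rewrite sqrtr_gt0 ltr0n.
apply: (big_ind (fun k : nat => k%:R <= _ :> R)).
- by rewrite !addr_ge0 ?mulr_ge0 ?ler0n ?(ltW t0).
- by move=> k l kle lle; rewrite natr_max ge_max kle.
move=> E freeE.
pose y a := (#|neighbours E a| - r.+1)%N.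
have Ey : #|E|%:R <= \sum_(a < m) (y a)%:R + m%:R * r.+1%:R :> R.
  rewrite -natr_sum -natrM -natrD ler_nat -sum_card_neighbours -[X in (_ + X * _)%N]card_ord.
  rewrite -sum_nat_const -big_split /=; apply: leq_sum => a _.
  by rewrite /y addnC -leq_subLR.
have := sum_expn_neighbours _ _ _ _ freeE; rewrite card_ord -(ler_nat R) natr_sum natrX => h.
have n2 : n%:R = t ^+ 2 :> R by rewrite sqr_sqrtr ?ler0n.
have {h} : \sum_(a < m) (t ^+ r.+1 + r.+1%:R * t ^+ r * ((y a)%:R - t)) <=
    t ^+ r.+1 * t ^+ r.+1.
  rewrite -exprMn -expr2 -n2; apply: le_trans h; apply: ler_sum => a _.
  by rewrite natrX expr_tangent_le ?ler0n // ltW.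
rewrite big_split /= sumr_const card_ord -mulr_sumr sumrB sumr_const card_ord.
rewrite -[_ *+ m]mulr_natr -[t *+ m]mulr_natr; set Y := \sum_(_ < _) _.
set w := t ^+ r => h; have w0 : 0 < w by rewrite exprn_gt0.
have tw : t ^+ r.+1 = t * w by rewrite exprS.
rewrite tw in h *; set v := `|_|.
have vle : t * w - m%:R <= v by rewrite ler_norm.
have v0 : 0 <= v by rewrite normr_ge0.
suff : Y <= m%:R * t + t * v by move: Ey; rewrite -/Y; lra.
have r1 : 1 <= r.+1%:R :> R by rewrite ler1n.
have h2 : r.+1%:R * (Y - t * m%:R) <= t * (t * w - m%:R).
  by rewrite -(ler_pM2l w0); lra.
have [neg|pos] := leP (Y - t * m%:R) 0; first by have := mulr_ge0 (ltW t0) v0; lra.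
have : Y - t * m%:R <= r.+1%:R * (Y - t * m%:R) by rewrite ler_peMl // ltW.
have : t * (t * w - m%:R) <= t * v by rewrite ler_pM2l.
lra.
Qed.

Lemma sqrt_prime_power (R : realType) (e : R) : 0 < e -> e <= 1 ->
  exists N : nat, forall n, (N <= n)%N -> exists q,
    [/\ prime_power q, (q ^ 2 <= n)%N & (1 - e) * Num.sqrt n%:R <= q%:R].
Proof.
move=> e0 e1; have [X XP] := @prime_power_between R e (introT andP (conj e0 e1)).
pose X' := Num.max X 0; exists (Num.truncn ((2 * X') ^+ 2)).+1 => n nX.
set t := Num.sqrt n%:R.
have X0 : 0 <= X' by rewrite le_max lexx orbT.
have t0 : 0 <= t by rewrite sqrtr_ge0.
have t2 : t ^+ 2 = n%:R by rewrite sqr_sqrtr ?ler0n.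
have tX : 2 * X' <= t.
  rewrite -ler_sqr ?nnegrE ?mulr_ge0 // t2; apply: ltW.
  by apply: lt_le_trans (truncnS_gt _) _; rewrite ler_nat.
(* Starting at t / (1 + e) puts the upper end of the interval at t = sqrt n, and 1 / (1 + e) >= 1 -
   e. *)
have [|q qP /andP[lo hi]] := XP (t / (1 + e)).
  apply: le_trans (_ : X' <= _); first by rewrite le_max lexx.
  by rewrite ler_pdivlMr; nra.
exists q; split=> //.
  rewrite -(ler_nat R) natrX -t2 lerXn2r ?nnegrE ?ler0n //.
  by move: hi; rewrite mulrC divfK // gt_eqF //; lra.
apply: le_trans (ltW lo); rewrite ler_pdivlMr; nra.
Qed.

Lemma natr_powR_half (R : realType) (n r : nat) :
  n%:R `^ (r%:R / 2) = Num.sqrt n%:R ^+ r :> R.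
Proof. by rewrite mulrC powRrM powR12_sqrt ?ler0n // powR_mulrn ?sqrtr_ge0. Qed.

Theorem zarankiewicz_2_asymptotic (R : realType) (r : nat) (m : nat -> nat) :
  (0 < r)%N ->
  (fun n : nat => (m n)%:R : R) ~_\oo (fun n : nat => n%:R `^ (r%:R / 2) : R) ->
  (fun n : nat => (zarankiewicz (m n) n 2 r)%:R : R) ~_\oo
    (fun n : nat => Num.sqrt n%:R * (m n)%:R : R).
Proof.
case: r => // r _ /eqaddoP mP; apply/eqaddoP => eps eps0.
(* The exponent is now r + 1. The lower bound loses r + 3 factors 1 - e: r + 1 from q^(r+1), one
   from comparing m with t^(r+1), one from the set size q. The upper bound loses 3 e, using t^(r+1)
   <= 2 m from e <= 1/2. *)
pose e : R := Num.min (1 / 2) (eps / r.+4%:R).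
have rR : 0 < r.+4%:R :> R by rewrite ltr0n.
have e0 : 0 < e by rewrite lt_min; apply/andP; split; [lra|exact: divr_gt0].
have e_half : e <= 1 / 2 by rewrite ge_min lexx.
have e_eps : r.+4%:R * e <= eps by rewrite mulrC -ler_pdivlMr // ge_min lexx orbT.
have [N1 _ hN1] := mP e e0.
have e1 : e <= 1 by lra.
have [N2 hN2] := sqrt_prime_power R e e0 e1.
pose N3 := (Num.truncn ((r.+1%:R / e) ^+ 2)).+1.
exists (maxn N1 (maxn N2 N3)) => // n /=; rewrite !geq_max => /andP[n1 /andP[n2 n3]].
have := hN1 n n1; rewrite /= natr_powR_half -/(_ - _).
have n0 : (0 < n)%N by apply: leq_trans n3.
have := zarankiewicz_2_le R (m n) n r n0.
have [q [qP qn tq]] := hN2 n n2.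
have := leq_zarankiewicz_poly q (m n) n r.+1 qP qn isT.
set t := Num.sqrt n%:R in tq *; set M := (m n)%:R; set z := zarankiewicz _ _ _ _.
have t0 : 0 < t by rewrite sqrtr_gt0 ltr0n.
have re : r.+1%:R <= e * t.
  rewrite mulrC -ler_pdivrMr // -ler_sqr ?nnegrE ?divr_ge0 ?ler0n ?(ltW e0) ?(ltW t0) //.
  rewrite sqr_sqrtr ?ler0n //; apply: ltW.
  by apply: lt_le_trans (truncnS_gt _) _; rewrite ler_nat.
set w := t ^+ r.+1; have w0 : 0 < w by rewrite exprn_gt0.
have M0 : 0 <= M by rewrite ler0n.
move=> zlo zhi Mw; have {}Mw : `|M - n%:R `^ (r.+1%:R / 2)| <= e * `|w| := Mw.
rewrite natr_powR_half -/t -/w [`|w|]gtr0_norm // in Mw.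
change (`|z%:R - t * M| <= eps * `|t * M|).
rewrite [`|t * M|]ger0_norm ?mulr_ge0 ?(ltW t0) //.
have [wlo whi] : (1 - e) * w <= M /\ M <= (1 + e) * w.
  by move: Mw; rewrite ler_norml => /andP[]; split; lra.
have w2M : w <= 2 * M by nra.
have hi : z%:R <= t * M + eps * (t * M).
  apply: le_trans zhi _; rewrite [X in _ + t * X + _]distrC.
  have h1 : t * `|M - w| <= t * (e * (2 * M)).
    by rewrite ler_pM2l //; apply: le_trans Mw _; rewrite ler_pM2l.
  have h2 : M * r.+1%:R <= M * (e * t) by rewrite ler_wpM2l.
  have h3 : 3 * e <= eps.
    by apply: le_trans e_eps; rewrite ler_pM2r // (ler_nat R 3).
  have h4 : 3 * e * (t * M) <= eps * (t * M) by rewrite ler_wpM2r // mulr_ge0 // ltW.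
  lra.
have lo : (1 - r.+3%:R * e) * (t * M) <= z%:R.
  have f0 : 0 <= 1 - e by lra.
  have bern := @expr_tangent_le R (1 - e) 1 r.+2 f0 ler01.
  apply: le_trans (_ : (1 - e) ^+ r.+3 * (t * M) <= _).
    rewrite ler_wpM2r ?mulr_ge0 ?(ltW t0) //.
    by move: bern; rewrite !expr1n; lra.
  have qr : (1 - e) ^+ r.+2 * M <= (q ^ r.+1)%N%:R.
    rewrite natrX; apply: le_trans (_ : ((1 - e) * t) ^+ r.+1 <= _); last first.
      by rewrite lerXn2r ?nnegrE ?ler0n ?mulr_ge0 ?(ltW t0).
    rewrite exprMn exprSr -mulrA ler_wpM2l ?exprn_ge0 //.
    by apply: le_trans (ler_wpM2l f0 whi) _; rewrite mulrA ger_pMl -/w //; nra.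
  have qm : (1 - e) ^+ r.+2 * M <= M by rewrite ler_piMl // exprn_ile1 //; lra.
  have min_ge : (1 - e) ^+ r.+2 * M <= (minn (m n) (q ^ r.+1))%:R.
    by case: (leqP (m n) (q ^ r.+1)).
  apply: le_trans (_ : (minn (m n) (q ^ r.+1) * q)%:R <= _); last by rewrite ler_nat.
  rewrite natrM exprSr [_ * (t * M)](_ : _ = (1 - e) ^+ r.+2 * M * ((1 - e) * t)); last by ring.
  by apply: ler_pM => //; rewrite mulr_ge0 ?exprn_ge0 ?(ltW t0).
have r3 : r.+3%:R * e <= eps.
  by apply: le_trans e_eps; rewrite ler_pM2r // ler_nat.
have tM : 0 <= t * M by rewrite mulr_ge0 // ltW.
have := ler_wpM2r tM r3; rewrite ler_norml; lra.
Qed.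

Theorem theorem10 (R : realType) :
  (forall q n m : nat,
     prime_power q -> n = (q ^ 2 + 1)%N -> m = (q * n)%N ->
     zarankiewicz m n 2 3 = ((q ^ 2 + q) * n)%N) /\
  (forall (r : nat) (m : nat -> nat),
     (4 <= r)%N ->
     (fun n : nat => (m n)%:R : R) ~_\oo
       (fun n : nat => n%:R `^ (r%:R / 2) : R) ->
     (fun n : nat => (zarankiewicz (m n) n 2 r)%:R : R) ~_\oo
       (fun n : nat => Num.sqrt n%:R * (m n)%:R : R)).
Proof.
split=> [q n m qP -> ->|r m r4]; first exact: zarankiewicz_2_3.
by apply: zarankiewicz_2_asymptotic; apply: leq_trans r4.
Qed.
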